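(* Let $\gamma>0$ and $T>0$. For $H\in(0,1]$ let $B_H=\{B_H(t):t\ge 0\}$ be a fractional Brownian motion with Hurst parameter $H$, and let $$K_T(H,\gamma):=\mathbb{E}\left[\left(\sup_{t\in[0,T]}|B_H(t)|\right)^{\gamma}\right].$$ Then (i) $$K_T(1/2,\gamma)=\frac{1}{\sqrt{\pi}}\,2^{1+\frac{\gamma}{2}}\,\Gamma\left(\frac{\gamma+1}{2}\right)\beta(\gamma)\,T^{\frac{\gamma}{2}},$$ where $\beta(s)=\sum_{k=0}^{\infty}(-1)^k(2k+1)^{-s}$ for $s>0$; (ii) $$K_T(1,\gamma)=\frac{1}{\sqrt{\pi}}\,2^{\frac{\gamma}{2}}\,\Gamma\left(\frac{\gamma+1}{2}\right)T^{\gamma}.$$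
   Context: A fractional Brownian motion with Hurst parameter $H\in(0,1]$ is a centered Gaussian process $\{B_H(t):t\ge0\}$ with stationary increments and variance function $\mathrm{Var}(B_H(t))=t^{2H}$ (so $B_H(0)=0$ a.s.); as usual, it is taken with continuous sample paths. In particular $B_{1/2}$ is standard Brownian motion. $\Gamma$ denotes the Euler Gamma function. The function $\beta$ is the Dirichlet beta function; for $s>0$ its defining series $\sum_{k=0}^{\infty}(-1)^k(2k+1)^{-s}$ is understood as the limit of its partial sums (the convergence is only conditional when $0<s\le 1$). *)

(* Defs.v *)
From HB Require Import structures.
From mathcomp Require Import all_boot all_order all_algebra.
From mathcomp Require Import all_classical all_reals all_analysis.

Import Order.TTheory GRing.Theory Num.Theory.
Import numFieldNormedType.Exports.

Local Open Scope classical_set_scope.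
Local Open Scope ring_scope.

(* Degenerate Gaussian laws are point masses; they need a separate clause since
   [normal_prob m 0] is by convention a uniform law. *)
Definition gaussian {d : measure_display} {Om : measurableType d}
    {R : realType} (P : probability Om R) (X : Om -> R) : Prop :=
  exists m s : R, 0 <= s /\
    forall A : set R, measurable A ->
      P (X @^-1` A) = if s == 0 then \d_m A else normal_prob m s A.

(* Processes are indexed by the whole of [R], but only times [0 <= t] are
   constrained or used. *)
Definition gaussian_process {d : measure_display} {Om : measurableType d}
    {R : realType} (P : probability Om R) (B : R -> {RV P >-> R}) : Prop :=
  forall (n : nat) (t a : 'I_n -> R), (forall i, 0 <= t i) ->
    gaussian P (fun w => \sum_(i < n) a i * B (t i) w).

(* Equality of all finite-dimensional distributions of
   [B (h + _) - B h] and [B _ - B 0]. *)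
Definition stationary_increments {d : measure_display} {Om : measurableType d}
    {R : realType} (P : probability Om R) (B : R -> {RV P >-> R}) : Prop :=
  forall (h : R) (n : nat) (t : 'I_n -> R), 0 <= h -> (forall i, 0 <= t i) ->
    forall A : set (n.-tuple R), measurable A ->
      P [set w | A [tuple B (h + t i) w - B h w | i < n]] =
      P [set w | A [tuple B (t i) w - B 0 w | i < n]].

Record fractional_brownian_motion {d : measure_display}
    {Om : measurableType d} {R : realType} (P : probability Om R) (H : R)
    (B : R -> {RV P >-> R}) : Prop := {
  fbm_hurst : 0 < H <= 1 ;
  fbm_gaussian : gaussian_process P B ;
  fbm_centered : forall t, 0 <= t -> 'E_P[B t]%E = 0%E ;
  fbm_stationary : stationary_increments P B ;
  fbm_variance : forall t, 0 <= t -> 'V_P[B t]%E = (t `^ (2 * H))%:E ;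
  fbm_continuous : forall w, {within `[0, +oo[, continuous (fun t => B t w)} }.

Definition sup_moment {d : measure_display} {Om : measurableType d}
    {R : realType} (P : probability Om R) (B : R -> {RV P >-> R})
    (T gamma : R) : \bar R :=
  'E_P[fun w => (sup [set `|B t w| | t in `[0, T]] `^ gamma)%R]%E.

Definition euler_gamma {R : realType} (s : R) : R :=
  \int[lebesgue_measure]_(x in `]0, +oo[) (x `^ (s - 1) * expR (- x)).

Definition dirichlet_beta {R : realType} (s : R) : R :=
  limn (fun n : nat =>
    \sum_(0 <= k < n) (-1) ^+ k * (2 * k + 1)%:R `^ (- s) : R).

(* Main.v *)
Require Import Defs.
From HB Require Import structures.
From mathcomp Require Import all_boot all_order all_algebra.
From mathcomp Require Import all_classical all_reals all_analysis.
From mathcomp Require Import measurable_realfun zify ring lra.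
Set Implicit Arguments.
Unset Strict Implicit.
Unset Printing Implicit Defensive.

Import Order.TTheory GRing.Theory Num.Theory.
Import numFieldNormedType.Exports.

Local Open Scope classical_set_scope.
Local Open Scope ring_scope.

(** Write M for the maximum of |B| on [0, T].

    For H = 1 the covariance function is s t, so that almost surely
    B t = (t / T) B T for all t in [0, T] ([fbm1_linear]), M = |B T|, and the
    result is the absolute moment of order gamma of a centered Gaussian variable
    ([normal_abs_moment]).

    For H = 1 / 2 the law of M comes from one reflection.  Let g be the square
    wave of period 4 x which is 1 on ]- x, x[ and - 1 on ]x, 3 x[; it is odd about
    x and about - x.  If the path leaves [- x, x] before T, it does so at x or
    - x, and from there it is symmetric, so g (B T) has conditional expectation 0;
    if it does not, then g (B T) = 1.  Hence P (M <= x) is the expectation of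
    g (B T), that is
      P (M > x) = 2 sum_j P ((4 j + 1) x < |B T| <= (4 j + 3) x)
    ([path_max_tail]).  Integrating this against the derivative of x ^ gamma turns
    the j-th band into the moment of order gamma of |B T|, multiplied by
    (4 j + 1) ^ - gamma - (4 j + 3) ^ - gamma, and these differences add up to the
    Dirichlet beta function ([brownian_maximum_moment_series],
    [dirichlet_beta_pairs]).

    The reflection is carried out in discrete time, on the grid of step
    T / (n + 1), for Lipschitz approximations of g ([two_sided_reflection]).  The
    first exit along the grid overshoots x or - x by at most one step of the
    path, which uniform continuity makes negligible.  Symmetry after a grid time
    is [brownian_reflection]: the path up to that time together with B T has the
    same joint law as with the reflected value of B T, because all linear
    combinations are centered Gaussian with equal variances.

    That linear combinations determine joint laws is proved for the class
    [trig_limit] of bounded pointwise limits of trigonometric polynomials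
    ([trig_limit_joint]).  The class is an algebra, and explicit polynomials of
    cosines converge to the sign of a cosine; hence it contains both the square
    waves and the indicators of half-lines, and no integral transform is
    inverted. *)

(** * Bounded pointwise limits of trigonometric polynomials *)

Section sign_approximation.
Context {R : realType}.
Implicit Types (u c v : R) (n k : nat).

Lemma bernoulli_ineq v k : 0 <= v <= 1 -> 1 - v *+ k <= (1 - v) ^+ k.
Proof.
move=> /andP[v0 v1]; elim: k => [|k IH]; first by rewrite expr0 mulr0n subr0.
rewrite exprS mulrSr; have : (1 - v) * (1 - v *+ k) <= (1 - v) * (1 - v) ^+ k.
  by apply: ler_wpM2l IH; lra.
apply: le_trans; have : 0 <= v * (v *+ k) by rewrite mulr_ge0// mulrn_wge0.
by nra.
Qed.

(** Each factor 1 - v is at most the inverse of 1 + v. *)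
Lemma bernoulli_inv v k : 0 <= v <= 1 -> (1 - v) ^+ k * (1 + v *+ k) <= 1.
Proof.
move=> /andP[v0 v1]; elim: k => [|k IH]; first by rewrite mulr0n addr0 mulr1.
have p0 : 0 <= (1 - v) ^+ k by rewrite exprn_ge0//; lra.
have w0 : 0 <= v *+ k by rewrite mulrn_wge0.
rewrite exprS mulrSr; apply: le_trans IH.
rewrite mulrAC mulrC; apply: ler_wpM2l => //.
by nra.
Qed.

(** A polynomial that tends on [0, 1] to the indicator of u < 1 / 2: the power
    2 ^ n wipes out 1 - u ^ n exactly when u ^ n is large compared with
    2 ^ - n (Brosowski and Deutsch, in their proof of the theorem of Stone and
    Weierstrass). *)
Definition step_poly n u := (1 - u ^+ n) ^+ (2 ^ n).

Lemma step_poly_bnd n u : 0 <= u <= 1 -> 0 <= step_poly n u <= 1.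
Proof.
move=> /andP[u0 u1]; have : 0 <= u ^+ n <= 1 by rewrite exprn_ge0//= exprn_ile1.
move=> /andP[p0 p1].
by rewrite /step_poly exprn_ge0 ?exprn_ile1//; lra.
Qed.

Lemma step_poly_cvg1 u : 0 <= u < 1 / 2 -> step_poly ^~ u @ \oo --> (1 : R).
Proof.
move=> /andP[u0 u1].
apply: (@squeeze_cvgr _ _ _ _ (fun n => 1 - (u * 2) ^+ n) (fun=> 1)).
- near=> n; have un : 0 <= u ^+ n <= 1.
    by rewrite exprn_ge0// exprn_ile1//; lra.
  have /andP[_ s1] : 0 <= step_poly n u <= 1 by apply: step_poly_bnd; lra.
  rewrite s1 andbT.
  apply: le_trans (bernoulli_ineq (2 ^ n) un).
  by rewrite exprMn -natrX mulr_natr.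
- rewrite -[X in _ --> X]subr0; apply: cvgB; first exact: cvg_cst.
  by apply: cvg_expr; rewrite ger0_norm; lra.
- exact: cvg_cst.
Unshelve. all: by end_near. Qed.

Lemma step_poly_cvg0 u : 1 / 2 < u <= 1 -> step_poly ^~ u @ \oo --> (0 : R).
Proof.
move=> /andP[u0 u1].
apply: (@squeeze_cvgr _ _ _ _ (fun=> 0) (fun n => ((u * 2)^-1) ^+ n)).
- near=> n; have un : 0 <= u ^+ n <= 1.
    by rewrite exprn_ge0 ?exprn_ile1//; lra.
  have := @bernoulli_inv _ (2 ^ n) un.
  have /andP[s0 _] : 0 <= step_poly n u <= 1 by apply: step_poly_bnd; lra.
  rewrite s0 /= -/(step_poly n u) -(mulr_natr (u ^+ n)) natrX -exprMn => h.
  have p0 : 0 < (u * 2) ^+ n by rewrite exprn_gt0//; lra.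
  rewrite exprVn -[leRHS]mul1r ler_pdivlMr//; apply: le_trans h.
  by apply: ler_wpM2l => //; lra.
- exact: cvg_cst.
- apply: cvg_expr; rewrite ger0_norm ?invr_ge0; last lra.
  by rewrite invf_lt1; lra.
Unshelve. all: by end_near. Qed.

(** The difference of two mirror images is odd, so that the limit is also the
    right one at c = 0, where each term alone tends to exp (- 1). *)
Definition sgn_approx n c :=
  step_poly n ((1 - c) / 2) - step_poly n ((1 + c) / 2).

Lemma sgn_approxN n c : sgn_approx n (- c) = - sgn_approx n c.
Proof. by rewrite /sgn_approx opprK opprB. Qed.

Lemma sgn_approx_le1 n c : `|c| <= 1 -> `|sgn_approx n c| <= 1.
Proof.
rewrite ler_norml => /andP[c0 c1]; rewrite /sgn_approx.
have /andP[a0 a1] : 0 <= step_poly n ((1 - c) / 2) <= 1 by apply: step_poly_bnd; lra.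
have /andP[b0 b1] : 0 <= step_poly n ((1 + c) / 2) <= 1 by apply: step_poly_bnd; lra.
by rewrite ler_norml; lra.
Qed.

Lemma sgn_approx_cvg c : `|c| <= 1 -> sgn_approx ^~ c @ \oo --> Num.sg c.
Proof.
rewrite ler_norml => /andP[c0 c1]; rewrite /sgn_approx.
have [h|h|->] := ltgtP c 0.
- rewrite ltr0_sg// -[X in _ --> X]add0r; apply: cvgB.
    by apply: step_poly_cvg0; lra.
  by apply: step_poly_cvg1; lra.
- rewrite gtr0_sg// -[X in _ --> X]subr0; apply: cvgB.
    by apply: step_poly_cvg1; lra.
  by apply: step_poly_cvg0; lra.
- rewrite sgr0 subr0 addr0 (_ : (fun n => _) = cst 0); first exact: cvg_cst.
  by apply/funext => n; rewrite subrr.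
Qed.

Lemma lipschitz_expr u v k : `|u| <= 1 -> `|v| <= 1 ->
  `|u ^+ k - v ^+ k| <= `|u - v| *+ k.
Proof.
move=> u1 v1; rewrite subrXX normrM -[leRHS]mulr_natr ler_wpM2l//.
apply: le_trans (ler_norm_sum _ _ _) _.
rewrite -[X in _ <= X%:R]card_ord -sumr_const.
apply: ler_sum => i _; rewrite normrM !normrX.
by rewrite mulr_ile1// ?exprn_ge0// exprn_ile1.
Qed.

Lemma lipschitz_step_poly n u v : 0 <= u <= 1 -> 0 <= v <= 1 ->
  `|step_poly n u - step_poly n v| <= `|u - v| *+ (n * 2 ^ n).
Proof.
move=> /andP[u0 u1] /andP[v0 v1].
have bnd (w : R) : 0 <= w -> w <= 1 -> `|1 - w ^+ n| <= 1.
  move=> w0 w1; have : 0 <= w ^+ n <= 1 by rewrite exprn_ge0// exprn_ile1.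
  by move=> ?; rewrite ler_norml; lra.
rewrite /step_poly; apply: le_trans (lipschitz_expr _ (bnd _ _ _) (bnd _ _ _)) _ => //.
rewrite mulrnA ler_wMn2r// (_ : _ - _ = - (u ^+ n - v ^+ n)); last by ring.
by rewrite normrN; apply: lipschitz_expr; rewrite ger0_norm.
Qed.

Lemma lipschitz_sgn_approx n c v : `|c| <= 1 -> `|v| <= 1 ->
  `|sgn_approx n c - sgn_approx n v| <= `|c - v| *+ (n * 2 ^ n).
Proof.
rewrite ler_norml => /andP[c0 c1].
rewrite ler_norml => /andP[v0 v1]; rewrite /sgn_approx.
rewrite [X in `|X|](_ : _ =
  (step_poly n ((1 - c) / 2) - step_poly n ((1 - v) / 2)) -
  (step_poly n ((1 + c) / 2) - step_poly n ((1 + v) / 2))); last by ring.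
apply: le_trans (ler_normB _ _) _.
apply: le_trans (lerD (lipschitz_step_poly n _ _) (lipschitz_step_poly n _ _)) _; try lra.
rewrite -mulrnDl ler_wMn2r//.
rewrite (_ : (1 - c) / 2 - (1 - v) / 2 = - ((c - v) / 2)); last by field.
rewrite (_ : (1 + c) / 2 - (1 + v) / 2 = (c - v) / 2); last by field.
by rewrite normrN normrM (ger0_norm (_ : 0 <= 2^-1)) ?invr_ge0//; lra.
Qed.

End sign_approximation.

Section trigonometric_limits.
Context {R : realType}.
Implicit Types (f g h : R -> R) (a b c : R).

(** The test functions used to compare laws.  An identity between expectations
    which is linear in the test function, and holds for all cosines, extends to
    this class by dominated convergence. *)
Inductive trig_limit : (R -> R) -> Prop :=
| trig_limit_cos a b : trig_limit (fun y => cos (a * y + b))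
| trig_limitD f g : trig_limit f -> trig_limit g -> trig_limit (f \+ g)
| trig_limitZ c f : trig_limit f -> trig_limit (fun y => c * f y)
| trig_limit_lim (f_ : nat -> R -> R) g M : (forall n, trig_limit (f_ n)) ->
    (forall n y, `|f_ n y| <= M) -> (forall y, f_ ^~ y @ \oo --> g y) ->
    trig_limit g.

Lemma trig_limit_eq f g : f =1 g -> trig_limit f -> trig_limit g.
Proof. by move=> /funext ->. Qed.

Lemma trig_limit_bounded f : trig_limit f -> exists M, forall y, `|f y| <= M.
Proof.
elim=> [a b|{}f g _ [M fM] _ [N gN]|c {}f _ [M fM]|f_ g M _ _ fM fg].
- by exists 1 => y; rewrite ler_norml cos_geN1 cos_le1.
- by exists (M + N) => y; apply: le_trans (ler_normD _ _) _; exact: lerD.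
- by exists (`|c| * M) => y; rewrite normrM ler_wpM2l.
- exists M => y; have /cvg_norm fgn := fg y.
  rewrite -(cvg_lim _ fgn)//; apply: limr_le; first by apply/cvg_ex; exists `|g y|.
  by near=> n.
Unshelve. all: by end_near. Qed.

Lemma trig_limit_measurable f : trig_limit f -> measurable_fun setT f.
Proof.
elim=> [a b|{}f g _ mf _ mg|c {}f _ mf|f_ g M _ mf fM fg].
- apply: continuous_measurable_fun => y; apply: continuous_comp.
    apply: cvgD; last exact: cvg_cst.
    by apply: cvgM; [exact: cvg_cst|exact: cvg_id].
  exact: continuous_cos.
- exact: measurable_funD.
- exact: measurable_funM.
- by apply: (measurable_fun_cvg (h := f_)).
Qed.

Lemma mul_cos_cos a b : cos a * cos b = 1 / 2 * cos (a + b) + 1 / 2 * cos (a - b).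
Proof. by rewrite cosB cosD; field. Qed.

(** A product of two cosines is a sum of two cosines; limits are then handled
    one factor at a time, which is where boundedness matters. *)
Lemma trig_limitM f g : trig_limit f -> trig_limit g ->
  trig_limit (fun y => f y * g y).
Proof.
move=> tf tg; elim: tf => [a b|f1 f2 _ t1 _ t2|c f1 _ t1|f_ h M _ tfg fM fh].
- elim: tg => [a' b'|g1 g2 _ t1 _ t2|c g1 _ t1|g_ h M _ tfg gM gh].
  + have t := trig_limitD
      (trig_limitZ (1 / 2) (trig_limit_cos (a + a') (b + b')))
      (trig_limitZ (1 / 2) (trig_limit_cos (a - a') (b - b'))).
    apply: trig_limit_eq t => y /=; rewrite mul_cos_cos.
    by congr (_ * cos _ + _ * cos _); ring.
  + by apply: trig_limit_eq (trig_limitD t1 t2) => y /=; rewrite mulrDr.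
  + by apply: trig_limit_eq (trig_limitZ c t1) => y /=; rewrite mulrCA.
  + apply: (trig_limit_lim (M := M) tfg) => [n y|y].
      rewrite normrM -[leRHS]mul1r ler_pM// ler_norml.
      by rewrite cos_geN1 cos_le1.
    by apply: cvgM; [exact: cvg_cst|exact: gh].
- by apply: trig_limit_eq (trig_limitD t1 t2) => y /=; rewrite mulrDl.
- by apply: trig_limit_eq (trig_limitZ c t1) => y /=; rewrite mulrA.
- have [N gN] := trig_limit_bounded tg.
  apply: (trig_limit_lim (M := M * N) tfg) => [n y|y].
    by rewrite normrM ler_pM.
  by apply: cvgM; [exact: fh|exact: cvg_cst].
Qed.

Lemma trig_limit_cst c : trig_limit (cst c).
Proof.
apply: trig_limit_eq (trig_limitZ c (trig_limit_cos 0 0)) => y /=.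
by rewrite mul0r addr0 cos0 mulr1.
Qed.

Lemma trig_limitX f n : trig_limit f -> trig_limit (fun y => f y ^+ n).
Proof.
move=> tf; elim: n => [|n IH].
  by apply: trig_limit_eq (trig_limit_cst 1) => y /=; rewrite expr0.
by apply: trig_limit_eq (trig_limitM tf IH) => y /=; rewrite exprS.
Qed.

Lemma trig_limitN f : trig_limit f -> trig_limit (fun y => - f y).
Proof. by move/(trig_limitZ (-1)); apply: trig_limit_eq => y; rewrite mulN1r. Qed.

Lemma trig_limitB f g : trig_limit f -> trig_limit g ->
  trig_limit (fun y => f y - g y).
Proof. by move=> tf /trig_limitN; exact: trig_limitD. Qed.

Lemma trig_limit_step_poly n f : trig_limit f ->
  trig_limit (fun y => step_poly n (f y)).
Proof.
move=> tf; apply: trig_limitX; apply: trig_limitB; first exact: trig_limit_cst.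
exact: trig_limitX.
Qed.

Lemma trig_limit_sgn_approx n a b :
  trig_limit (fun y => sgn_approx n (cos (a * y + b))).
Proof.
have t2 f : trig_limit f -> trig_limit (fun y => f y / 2).
  by move/(trig_limitZ 2^-1); apply: trig_limit_eq => y; rewrite mulrC.
by apply: trig_limitB; apply: trig_limit_step_poly; apply: t2;
  [apply: trig_limitB|apply: trig_limitD];
  (exact: trig_limit_cst || exact: trig_limit_cos).
Qed.

Lemma trig_limit_sg_cos a b : trig_limit (fun y => Num.sg (cos (a * y + b))).
Proof.
have cos1 y : `|cos y : R| <= 1 by rewrite ler_norml cos_geN1 cos_le1.
apply: (trig_limit_lim (M := 1) (fun n => trig_limit_sgn_approx n a b)).
- by move=> n y; exact: sgn_approx_le1.
- by move=> y; exact: sgn_approx_cvg.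
Qed.

(** For fixed y, sin ((y - c) / n) has the sign of y - c as soon as n pi exceeds
    |y - c|: slower and slower square waves tend to the sign function. *)
Lemma trig_limit_sg c : trig_limit (fun y => Num.sg (y - c)).
Proof.
apply: (trig_limit_lim (M := 1)
  (fun n => trig_limit_sg_cos (n.+1%:R^-1) (- (c / n.+1%:R) - pi / 2))).
  by move=> n y; rewrite normr_sg; case: (_ != _).
move=> y; apply: cvg_near_cst; near=> n.
rewrite (_ : _ + _ = (y - c) / n.+1%:R - pi / 2); last by ring.
rewrite -sinDpihalf subrK.
have n0 : 0 < n.+1%:R :> R by [].
have ltpi (z : R) : 0 <= z -> z <= `|y - c| -> z / n.+1%:R < pi.
  move=> z0 zn; rewrite ltr_pdivrMr//.
  have : z / pi < n.+1%:R.
    apply: (@le_lt_trans _ _ (`|y - c| / pi)).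
      by rewrite ler_pM2r// invr_gt0 pi_gt0.
    apply: (@le_lt_trans _ _ n%:R); last by rewrite ltr_nat.
    by near: n; exact: nbhs_infty_ger.
  by rewrite ltr_pdivrMr ?pi_gt0// mulrC.
have [h|h|h] := ltgtP (y - c) 0.
- rewrite (ltr0_sg h) ltr0_sg// -oppr_gt0 -sinN sin_gt0_pi// -mulNr.
  rewrite divr_gt0 ?oppr_gt0//=.
  by apply: ltpi; [rewrite oppr_ge0 ltW|rewrite ltr0_norm].
- rewrite (gtr0_sg h) gtr0_sg// sin_gt0_pi// divr_gt0//=.
  by apply: ltpi; [rewrite ltW|rewrite gtr0_norm].
- by rewrite h mul0r sin0 sgr0.
Unshelve. all: by end_near. Qed.

Lemma trig_limit_gt c : trig_limit (fun y => (c < y)%R%:R).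
Proof.
have tsg := trig_limit_sg c.
apply: trig_limit_eq (trig_limitZ (1 / 2) (trig_limitD tsg (trig_limitM tsg tsg))).
move=> y /=; rewrite -subr_gt0.
by have [h|h|<-] := ltgtP 0 (y - c);
  [rewrite gtr0_sg|rewrite ltr0_sg|rewrite sgr0]; rewrite //=; field.
Qed.

Lemma trig_limit_norm_gt c : 0 <= c -> trig_limit (fun y => (c < `|y|)%R%:R).
Proof.
move=> c0; have tsg := trig_limit_sg (- c).
have tlt := trig_limitZ (1 / 2) (trig_limitB (trig_limitM tsg tsg) tsg).
apply: trig_limit_eq (trig_limitD (trig_limit_gt c) tlt) => y /=.
have -> : 1 / 2 * (Num.sg (y - - c) * Num.sg (y - - c) - Num.sg (y - - c)) =
    (y < - c)%R%:R.
  rewrite -(subr_lt0 (- c)).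
  by have [h|h|->] := ltgtP (y - - c) 0;
    [rewrite ltr0_sg|rewrite gtr0_sg|rewrite sgr0]; rewrite //=; field.
rewrite ltr_normr (ltrNr c y).
case: (ltP c y) => h1; case: (ltP y (- c)) => h2 /=; rewrite ?mulr0n ?addr0 ?add0r//.
by exfalso; lra.
Qed.

Lemma trig_limit_norm_le c : 0 <= c -> trig_limit (fun y => (`|y| <= c)%R%:R).
Proof.
move=> c0; apply: trig_limit_eq (trig_limitB (trig_limit_cst 1) (trig_limit_norm_gt c0)).
by move=> y /=; case: ltP; rewrite ?subr0 ?subrr.
Qed.

End trigonometric_limits.

(** * Expectations of bounded functions and joint laws *)

Section bounded_functions.
Context {d : measure_display} {Om : measurableType d} {R : realType}.
Variable P : probability Om R.
Implicit Types (f g U X : Om -> R) (c M : R).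

Definition bounded_rv f :=
  measurable_fun setT f /\ exists M, forall w, `|f w| <= M.

Lemma bounded_rv_integrable f : bounded_rv f -> P.-integrable setT (EFin \o f).
Proof.
move=> [mf [M fM]]; apply: (@le_integrable _ _ _ P setT measurableT _ (EFin \o cst M)) => //.
- exact/measurable_EFinP.
- by move=> w _ /=; rewrite lee_fin; apply: le_trans (fM w) (ler_norm _).
- exact: finite_measure_integrable_cst.
Qed.

Lemma bounded_rv_cst c : bounded_rv (cst c).
Proof. by split; [exact: measurable_cst|exists `|c|]. Qed.

Lemma bounded_rvD f g : bounded_rv f -> bounded_rv g -> bounded_rv (f \+ g).
Proof.
move=> [mf [M fM]] [mg [N gN]]; split; first exact: measurable_funD.
by exists (M + N) => w; apply: le_trans (ler_normD _ _) _; exact: lerD.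
Qed.

Lemma bounded_rvM f g : bounded_rv f -> bounded_rv g ->
  bounded_rv (fun w => f w * g w).
Proof.
move=> [mf [M fM]] [mg [N gN]]; split; first exact: measurable_funM.
by exists (M * N) => w; rewrite normrM ler_pM.
Qed.

Lemma bounded_rvZ c f : bounded_rv f -> bounded_rv (fun w => c * f w).
Proof. by move=> bf; apply: bounded_rvM bf; exact: bounded_rv_cst. Qed.

Lemma bounded_rvB f g : bounded_rv f -> bounded_rv g -> bounded_rv (f \- g).
Proof.
move=> bf /(bounded_rvZ (-1)) bg; rewrite (_ : _ \- _ = f \+ (fun w => -1 * g w)).
  exact: bounded_rvD.
by apply/funext => w /=; rewrite mulN1r.
Qed.

Lemma bounded_rv_sum (n : nat) (F : nat -> Om -> R) : (forall i, bounded_rv (F i)) ->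
  bounded_rv (fun w => \sum_(i < n) F i w).
Proof.
move=> bF; elim: n => [|n IH].
  by rewrite (_ : (fun w => _) = cst 0); [exact: bounded_rv_cst|
     apply/funext => w; rewrite big_ord0].
rewrite (_ : (fun w => _) = (fun w => \sum_(i < n) F i w) \+ F n).
  exact: bounded_rvD.
by apply/funext => w; rewrite big_ord_recr.
Qed.

Lemma bounded_rv_prod (n : nat) (F : nat -> Om -> R) : (forall i, bounded_rv (F i)) ->
  bounded_rv (fun w => \prod_(i < n) F i w).
Proof.
move=> bF; elim: n => [|n IH].
  by rewrite (_ : (fun w => _) = cst 1); [exact: bounded_rv_cst|
     apply/funext => w; rewrite big_ord0].
rewrite (_ : (fun w => _) = (fun w => (\prod_(i < n) F i w) * F n w)).
  exact: bounded_rvM.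
by apply/funext => w; rewrite big_ord_recr.
Qed.

Lemma bounded_rv_trig (phi : R -> R) X : trig_limit phi -> measurable_fun setT X ->
  bounded_rv (fun w => phi (X w)).
Proof.
move=> tphi mX; split.
  exact: (measurableT_comp (trig_limit_measurable tphi)).
by have [M phiM] := trig_limit_bounded tphi; exists M.
Qed.

Lemma bounded_rv_cos X : measurable_fun setT X -> bounded_rv (fun w => cos (X w)).
Proof.
move/(bounded_rv_trig (trig_limit_cos 1 0)).
by under eq_fun do rewrite mul1r addr0.
Qed.

Lemma Rint_bounded_cvg (f_ : nat -> Om -> R) f M :
  (forall n, measurable_fun setT (f_ n)) -> (forall n w, `|f_ n w| <= M) ->
  measurable_fun setT f -> {ae P, forall w, f_ ^~ w @ \oo --> f w} ->
  (fun n => \int[P]_w f_ n w) @ \oo --> \int[P]_w f w.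
Proof.
move=> mf_ fM mf f_f.
have [|||||ifn _ cv] := @dominated_convergence _ _ _ P setT measurableT
    (fun n => EFin \o f_ n) (EFin \o f) (EFin \o cst M).
- by move=> n; exact/measurable_EFinP.
- exact/measurable_EFinP.
- case: f_f => N [mN N0 NP]; exists N; split=> // w /= nfw; apply: NP => /= fw.
  by apply: nfw => _; apply: cvg_EFin fw; apply: nearW.
- exact: finite_measure_integrable_cst.
- by apply: aeW => w n _ /=; rewrite lee_fin.
by apply: fine_cvg; rewrite fineK//; exact: integrable_fin_num.
Qed.

Lemma trig_limit_transfer U U' X X' (phi : R -> R) :
  bounded_rv U -> bounded_rv U' -> measurable_fun setT X -> measurable_fun setT X' ->
  (forall a b, \int[P]_w (U w * cos (a * X w + b)) =
               \int[P]_w (U' w * cos (a * X' w + b))) ->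
  trig_limit phi ->
  \int[P]_w (U w * phi (X w)) = \int[P]_w (U' w * phi (X' w)).
Proof.
move=> bU bU' mX mX' UU'; elim=> [a b|f g tf IHf tg IHg|c f tf IH|f_ g M tf_ IH fM fg].
- exact: UU'.
- under eq_Rintegral do rewrite /= mulrDr.
  under [RHS]eq_Rintegral do rewrite /= mulrDr.
  by rewrite !RintegralD ?IHf ?IHg//;
    apply: bounded_rv_integrable; apply: bounded_rvM => //; exact: bounded_rv_trig.
- under eq_Rintegral do rewrite /= mulrCA.
  under [RHS]eq_Rintegral do rewrite /= mulrCA.
  by rewrite !RintegralZl ?IH//;
    apply: bounded_rv_integrable; apply: bounded_rvM => //; exact: bounded_rv_trig.
- have tg := trig_limit_lim tf_ fM fg.
  have cv V Y : bounded_rv V -> measurable_fun setT Y ->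
      (fun n => \int[P]_w (V w * f_ n (Y w))) @ \oo --> \int[P]_w (V w * g (Y w)).
    move=> bV mY; have [_ [N VN]] := bV.
    apply: (@Rint_bounded_cvg _ _ (N * M)).
    - by move=> n; have [] := bounded_rvM bV (bounded_rv_trig (tf_ n) mY).
    - by move=> n w; rewrite normrM ler_pM.
    - by have [] := bounded_rvM bV (bounded_rv_trig tg mY).
    - by apply: aeW => w; apply: cvgM; [exact: cvg_cst|exact: fg].
  have c1 := cv _ _ bU mX; have c2 := cv _ _ bU' mX'.
  rewrite -(cvg_lim _ c1)// -(cvg_lim _ c2)//; congr (lim (_ @ \oo)).
  by apply/funext => n; exact: IH.
Qed.

(** The laws of the linear combinations determine the joint law, here tested on
    products of test functions.  The coordinates are released one at a time:
    those still to be treated stay inside a single cosine, and its product with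
    cos (a X_k + b') is a sum of two cosines of linear combinations. *)
Lemma trig_limit_joint (k : nat) (X X' : nat -> Om -> R) (phi : nat -> R -> R) :
  (forall i, measurable_fun setT (X i)) -> (forall i, measurable_fun setT (X' i)) ->
  (forall i, trig_limit (phi i)) ->
  (forall (a : nat -> R) b,
    \int[P]_w cos (\sum_(i < k) a i * X i w + b) =
    \int[P]_w cos (\sum_(i < k) a i * X' i w + b)) ->
  \int[P]_w (\prod_(i < k) phi i (X i w)) = \int[P]_w (\prod_(i < k) phi i (X' i w)).
Proof.
move=> mX mX' tphi H.
(* Z gathers the coordinates that are still inside the cosine *)
suff main (Z Z' : Om -> R) : measurable_fun setT Z -> measurable_fun setT Z' ->
    (forall (a : nat -> R) b,
      \int[P]_w cos (\sum_(i < k) a i * X i w + Z w + b) =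
      \int[P]_w cos (\sum_(i < k) a i * X' i w + Z' w + b)) ->
    forall b, \int[P]_w ((\prod_(i < k) phi i (X i w)) * cos (Z w + b)) =
              \int[P]_w ((\prod_(i < k) phi i (X' i w)) * cos (Z' w + b)).
  have H0 (a : nat -> R) b :
      \int[P]_w cos (\sum_(i < k) a i * X i w + cst 0 w + b) =
      \int[P]_w cos (\sum_(i < k) a i * X' i w + cst 0 w + b).
    under eq_Rintegral do rewrite addr0.
    by under [RHS]eq_Rintegral do rewrite addr0.
  have := main _ _ (measurable_cst _) (measurable_cst _) H0 0.
  under eq_Rintegral do rewrite addr0 cos0 mulr1.
  by under [in X in _ = X -> _]eq_Rintegral do rewrite addr0 cos0 mulr1.
clear H; elim: k Z Z' => [|k IH] Z Z' mZ mZ' H b.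
  have := H (cst 0) b.
  under eq_Rintegral do rewrite big_ord0 add0r.
  under [in X in _ = X -> _]eq_Rintegral do rewrite big_ord0 add0r.
  under [in X in _ -> X = _]eq_Rintegral do rewrite big_ord0 mul1r.
  by under [in X in _ -> _ = X]eq_Rintegral do rewrite big_ord0 mul1r.
have bp (Y : nat -> Om -> R) : (forall i, measurable_fun setT (Y i)) ->
    bounded_rv (fun w => \prod_(i < k) phi i (Y i w)).
  by move=> mY; apply: (@bounded_rv_prod k (fun i w => phi i (Y i w))) => i;
    exact: bounded_rv_trig.
have bc (Y : Om -> R) e : measurable_fun setT Y -> bounded_rv (fun w => cos (Y w + e)).
  by move=> mY; apply: bounded_rv_cos; exact: measurable_funD.
under eq_Rintegral do rewrite big_ord_recr /= -mulrA [_ * cos _]mulrC mulrA.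
under [RHS]eq_Rintegral do rewrite big_ord_recr /= -mulrA [_ * cos _]mulrC mulrA.
apply: trig_limit_transfer => //; [by apply: bounded_rvM; auto..|].
move=> a b'.
have split (Y : nat -> Om -> R) (W : Om -> R) : (forall i, measurable_fun setT (Y i)) ->
    measurable_fun setT W ->
  \int[P]_w (\prod_(i < k) phi i (Y i w) * cos (W w + b) * cos (a * Y k w + b')) =
  1 / 2 * \int[P]_w (\prod_(i < k) phi i (Y i w) * cos ((W w + a * Y k w) + (b + b'))) +
  1 / 2 * \int[P]_w (\prod_(i < k) phi i (Y i w) * cos ((W w + - a * Y k w) + (b - b'))).
  move=> mY mW; rewrite -!RintegralZl//; last 2 first.
  - apply: bounded_rv_integrable; apply: bounded_rvM; first exact: bp.
    by apply: bc; apply: measurable_funD => //; exact: measurable_funM.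
  - apply: bounded_rv_integrable; apply: bounded_rvM; first exact: bp.
    by apply: bc; apply: measurable_funD => //; exact: measurable_funM.
  rewrite -RintegralD//; last 2 first.
  - apply: bounded_rv_integrable; apply: bounded_rvZ; apply: bounded_rvM; first exact: bp.
    by apply: bc; apply: measurable_funD => //; exact: measurable_funM.
  - apply: bounded_rv_integrable; apply: bounded_rvZ; apply: bounded_rvM; first exact: bp.
    by apply: bc; apply: measurable_funD => //; exact: measurable_funM.
  apply: eq_Rintegral => w _; rewrite -mulrA mul_cos_cos.
  rewrite (_ : W w + b + (a * Y k w + b') = W w + a * Y k w + (b + b')); last by ring.
  rewrite (_ : W w + b - (a * Y k w + b') = W w + - a * Y k w + (b - b')); last by ring.
  by ring.
have shift c : forall (a' : nat -> R) e,
    \int[P]_w cos (\sum_(i < k) a' i * X i w + (Z w + c * X k w) + e) =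
    \int[P]_w cos (\sum_(i < k) a' i * X' i w + (Z' w + c * X' k w) + e).
  move=> a' e; have := H (fun i => if i == k then c else a' i) e.
  have eqs (Y : nat -> Om -> R) (W : Om -> R) w :
      \sum_(i < k.+1) (if i == k :> nat then c else a' i) * Y i w + W w + e =
      \sum_(i < k) a' i * Y i w + (W w + c * Y k w) + e.
    rewrite big_ord_recr /= eqxx -addrA -addrA -!addrA; congr (_ + _); last by ring.
    by apply: eq_bigr => i _; rewrite ltn_eqF.
  under eq_Rintegral do rewrite eqs.
  by under [in X in _ = X -> _]eq_Rintegral do rewrite eqs.
by rewrite !split//; congr (_ * _ + _ * _); apply: IH => //;
  apply: measurable_funD => //; exact: measurable_funM.
Qed.

End bounded_functions.

(** * Moments of Gaussian laws *)

Section affine_change_of_variables.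
Context {R : realType}.
Local Notation mu := (@lebesgue_measure R).
Variables (m s : R) (s_gt0 : 0 < s).

Let aff : measurableTypeR R -> measurableTypeR R := fun y => m + s * y.

Let measurable_aff : measurable_fun setT aff.
Proof. by apply: measurable_funD => //; exact: measurable_funM. Qed.

Let image := pushforward mu aff.

Let image0 : image set0 = 0%E. Proof. exact: measure0. Qed.

Let image_ge0 A : (0 <= image A)%E. Proof. exact: measure_ge0. Qed.

Let image_sigma_additive : semi_sigma_additive image.
Proof. exact: measure_semi_sigma_additive. Qed.

HB.instance Definition _ := isMeasure.Build _ _ _ image
  image0 image_ge0 image_sigma_additive.

Let scaled_image : {measure set _ -> \bar R} := mscale (NngNum (ltW s_gt0)) image.

Lemma lebesgue_measure_affine (A : set R) : measurable A ->
  (s%:E * mu [set y | A (m + s * y)%R] = mu A)%E.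
Proof.
move=> mA; suff /(_ A mA) -> : forall A, measurable A ->
  mu A = scaled_image A by [].
apply: lebesgue_measure_unique => //= _ [[a b]] _ <-; rewrite /scaled_image.
rewrite /mscale /= /image /pushforward.
rewrite (_ : aff @^-1` _ = `](a - m) / s, (b - m) / s]%classic); last first.
  apply/seteqP; split=> y /=; rewrite !in_itv /=.
    by rewrite /aff ltr_pdivrMr// ler_pdivlMr// => /andP[? ?]; apply/andP; split; lra.
  by rewrite /aff ltr_pdivrMr// ler_pdivlMr// => /andP[? ?]; apply/andP; split; lra.
rewrite !lebesgue_measure_itv /= !lte_fin ltr_pM2r ?invr_gt0// ltrD2r.
case: ifP => ab; last by rewrite mule0.
rewrite -!EFinB -EFinM; congr EFin; field; rewrite gt_eqF//.
Qed.

Lemma ge0_integral_affine (f : R -> \bar R) : measurable_fun setT f ->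
  (forall x, 0 <= f x)%E ->
  (\int[mu]_x f x = s%:E * \int[mu]_y f (m + s * y)%R)%E.
Proof.
move=> mf f0; transitivity (\int[scaled_image]_x f x)%E.
  by apply: eq_measure_integral => A mA _; exact/esym/lebesgue_measure_affine.
rewrite /scaled_image ge0_integral_mscale//=; congr *%E.
by rewrite (ge0_integral_pushforward measurable_aff mu).
Qed.

End affine_change_of_variables.

Section standard_normal.
Context {R : realType}.
Local Notation mu := (@lebesgue_measure R).
Local Notation phi := (@normal_pdf R 0 1).
Implicit Types (m s : R).

Lemma ge0_integral_normal_prob m s (f : R -> \bar R) : measurable_fun setT f ->
  (forall x, 0 <= f x)%E ->
  (\int[normal_prob m s]_x f x = \int[mu]_x (f x * (normal_pdf m s x)%:E))%E.
Proof.
move=> mf f0.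
rewrite -(Radon_Nikodym_SigmaFinite.change_of_variables (normal_prob_dominates m s))//.
have ig := Radon_Nikodym_SigmaFinite.f_integrable (normal_prob_dominates m s).
have mpdf : measurable_fun setT (EFin \o normal_pdf m s).
  by apply/measurable_EFinP; exact: measurable_normal_pdf.
apply: ae_eq_integral => //.
- by apply: emeasurable_funM => //; exact: (measurable_int mu).
- exact: emeasurable_funM.
- apply: ae_eqe_mul2l => /=; apply: integral_ae_eq => //.
  by move=> E _ mE; rewrite -Radon_Nikodym_SigmaFinite.f_integral//; exact: normal_prob_dominates.
Qed.

Lemma normal_pdf_standardize m s y : 0 < s -> s * normal_pdf m s (m + s * y) = phi y.
Proof.
move=> s0; have sn0 : s != 0 by rewrite gt_eqF.
rewrite !normal_pdfE ?oner_neq0// /normal_peak /normal_fun mulrA; congr (_ * expR _).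
  rewrite expr1n mul1r -mulrnAr sqrtrM ?sqr_ge0// sqrtr_sqr gtr0_norm//.
  by rewrite invfM mulVKf.
by field.
Qed.

Lemma ge0_expectation_normal {d} {Om : measurableType d} (P : probability Om R)
    (X : Om -> R) m s (G : R -> R) :
  0 < s -> measurable_fun setT X ->
  (forall A, measurable A -> P (X @^-1` A) = normal_prob m s A) ->
  measurable_fun setT G -> (forall y, 0 <= G y) ->
  (\int[P]_w (G ((X w - m) / s))%:E = \int[mu]_y (G y * phi y)%:E)%E.
Proof.
move=> s0 mX lawX mG G0; pose f x := (G ((x - m) / s))%:E.
have mf : measurable_fun setT f.
  apply/measurable_EFinP; apply: (measurableT_comp mG).
  by apply: measurable_funM => //; exact: measurable_funB.
have f0 x : (0 <= f x)%E by rewrite lee_fin.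
transitivity (\int[pushforward P (X : Om -> measurableTypeR R)]_x f x)%E.
  by rewrite (@ge0_integral_pushforward _ _ _ (measurableTypeR R) _ _ mX).
transitivity (\int[normal_prob m s]_x f x)%E.
  by apply: eq_measure_integral => A mA _; exact: lawX.
have mpdf : measurable_fun setT (EFin \o normal_pdf m s).
  by apply/measurable_EFinP; exact: measurable_normal_pdf.
rewrite ge0_integral_normal_prob// (@ge0_integral_affine _ m s)//; last 2 first.
- exact: emeasurable_funM.
- by move=> x; rewrite mule_ge0// lee_fin normal_pdf_ge0.
rewrite -ge0_integralZl//; last 3 first.
- apply: emeasurable_funM.
    apply: (measurableT_comp mf).
    by apply: measurable_funD => //; exact: measurable_funM.
  apply: (measurableT_comp mpdf).
  by apply: measurable_funD => //; exact: measurable_funM.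
- by move=> y _; rewrite mule_ge0// lee_fin normal_pdf_ge0.
- by rewrite lee_fin ltW.
apply: eq_integral => y _; rewrite /f -!EFinM -(normal_pdf_standardize m y s0).
rewrite (_ : (m + s * y - m) / s = y); last by field; rewrite gt_eqF.
by congr EFin; ring.
Qed.

Lemma normal_pdfN y : phi (- y) = phi y.
Proof.
by rewrite !normal_pdfE ?oner_neq0// /normal_fun !subr0 sqrrN.
Qed.

Lemma ge0_integralN (f : R -> \bar R) : measurable_fun setT f ->
  (forall x, 0 <= f x)%E -> (\int[mu]_x f (- x)%R = \int[mu]_x f x)%E.
Proof.
move=> mf f0.
transitivity (\int[pushforward mu (-%R : _ -> measurableTypeR R)]_x f x)%E.
  by rewrite ge0_integral_pushforward.
by apply: eq_measure_integral => //= A mA _; exact: lebesgue_measureN.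
Qed.

(** The symmetry of the density, in the form which shows that the mean of a
    Gaussian variable is its location parameter. *)
Lemma integral_normal_pos_neg :
  (\int[mu]_y (Num.max y 0 * phi y)%:E = \int[mu]_y (Num.max (- y) 0 * phi y)%:E)%E.
Proof.
pose f y := (Num.max (- y) 0 * phi y)%:E.
rewrite -[RHS](@ge0_integralN f).
- by apply: eq_integral => y _; rewrite /f opprK normal_pdfN.
- apply/measurable_EFinP; apply: measurable_funM; last exact: measurable_normal_pdf.
  by apply: measurable_maxr => //; exact: measurable_funN.
- by move=> y; rewrite lee_fin mulr_ge0 ?normal_pdf_ge0// le_max lexx orbT.
Qed.

End standard_normal.

Section normal_second_moment.
Context {R : realType}.
Local Notation mu := (@lebesgue_measure R).
Local Notation phi := (@normal_pdf R 0 1).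

Let e (y : R) := expR (- (y ^+ 2 / 2)).

Let e_gt0 y : 0 < e y. Proof. exact: expR_gt0. Qed.

Let normal_pdf_e y : phi y = normal_peak 1 * e y.
Proof.
rewrite normal_pdfE ?oner_neq0// /normal_fun subr0 expr1n /e.
by congr (_ * expR _); rewrite mulNr.
Qed.

Let is_derive_e (y : R) : is_derive y 1 e (- y * e y).
Proof.
have -> : e = expR \o (fun y => - (y ^+ 2 / 2)) by [].
rewrite mulrC; apply: is_derive1_comp.
by apply: is_derive_eq; rewrite /GRing.scale /=; field.
Qed.

Let is_derive_ye (y : R) : is_derive y 1 (fun y => y * e y) ((1 - y ^+ 2) * e y).
Proof.
have -> : (fun y => y * e y) = id * e by [].
have := is_deriveM (is_derive_id y 1) (is_derive_e y).
move/is_derive_eq; apply; rewrite /GRing.scale /=; ring.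
Qed.

Let continuous_e : continuous e.
Proof. by move=> y; apply: differentiable_continuous; apply/derivable1_diffP. Qed.

Let continuous_sqr : continuous (fun y : R => y ^+ 2).
Proof. by move=> y; exact: exprn_continuous. Qed.

Let cvg_ye : (y * e y) @[y --> +oo] --> (0 : R).
Proof.
apply: (@squeeze_cvgr _ _ _ _ (fun=> 0) (fun y => 2 * y^-1)).
- near=> y; have y0 : 0 < y by near: y; exact: nbhs_pinfty_gt.
  have -> /= : 0 <= y * e y by apply: mulr_ge0; apply: ltW.
  rewrite /e expRN ler_pdivrMr ?expR_gt0//.
  have : 1 + y ^+ 2 / 2 <= expR (y ^+ 2 / 2) by exact: expR_ge1Dx.
  by rewrite [X in _ -> _ <= X]mulrAC ler_pdivlMr//; have := sqr_ge0 y; nra.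
- exact: cvg_cst.
- rewrite -[X in _ --> X](mulr0 2); apply: cvgM; first exact: cvg_cst.
  apply/gtr0_cvgV0; [exact: nbhs_pinfty_gt|exact: cvg_id].
Unshelve. all: by end_near. Qed.

Let se (y : R) := y ^+ 2 * e y.

Let continuous_se : continuous se.
Proof. by move=> y; apply: cvgM; [exact: continuous_sqr|exact: continuous_e]. Qed.

Let measurable_e (D : set R) : measurable_fun D (EFin \o e).
Proof.
apply/measurable_EFinP; apply: measurable_funTS.
exact: continuous_measurable_fun continuous_e.
Qed.

Let measurable_se (D : set R) : measurable_fun D (EFin \o se).
Proof.
apply/measurable_EFinP; apply: measurable_funTS.
exact: continuous_measurable_fun continuous_se.
Qed.

Let se_ge0 y : 0 <= se y.
Proof. by rewrite mulr_ge0// ?sqr_ge0// ltW. Qed.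

(** (1 - y ^ 2) e(y) is the derivative of y e(y).  It changes sign at 1 only, so
    the second moment and the mass are compared on [0, 1] and on [1, +oo[
    separately, each time with an integrand of constant sign; the two boundary
    terms cancel. *)
Let integral_se_left :
  (\int[mu]_(y in `[0%R, 1%R]) (e y)%:E =
   \int[mu]_(y in `[0%R, 1%R]) (se y)%:E + (e 1)%:E)%E.
Proof.
have <- : (\int[mu]_(y in `[0%R, 1%R]) ((1 - y ^+ 2) * e y)%:E = (e 1)%:E)%E.
  rewrite (@continuous_FTC2 _ _ (fun y => y * e y))//.
  - by rewrite mul0r mul1r sube0.
  - apply: continuous_subspaceT => y; apply: cvgM; last exact: continuous_e.
    by apply: cvgB; [exact: cvg_cst|exact: continuous_sqr].
  - split=> [y _||].
    + exact: ex_derive.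
    + apply: cvg_at_right_filter; apply: cvgM; [exact: cvg_id|exact: continuous_e].
    + apply: cvg_at_left_filter; apply: cvgM; [exact: cvg_id|exact: continuous_e].
  - by move=> y _; rewrite derive1E; exact: derive_val.
rewrite -ge0_integralD//.
- by apply: eq_integral => y _; rewrite -EFinD; congr EFin; rewrite /se; ring.
- by move=> y _; rewrite lee_fin.
- exact: measurable_se.
- move=> y /=; rewrite in_itv/= => /andP[y0 y1].
  by rewrite lee_fin; apply: mulr_ge0; [rewrite subr_ge0 exprn_ile1|exact: ltW].
- apply/measurable_EFinP; apply: measurable_funM; last first.
    by apply/measurable_EFinP; exact: measurable_e.
  by apply: measurable_funB => //; exact: measurable_funX.
Qed.

Let integral_se_right :
  (\int[mu]_(y in `[1%R, +oo[) (se y)%:E =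
   \int[mu]_(y in `[1%R, +oo[) (e y)%:E + (e 1)%:E)%E.
Proof.
have <- : (\int[mu]_(y in `[1%R, +oo[) (- ((1 - y ^+ 2) * e y))%:E = (e 1)%:E)%E.
  have d (y : R) : is_derive y 1 (fun y : R => - (y * e y)) (- ((1 - y ^+ 2) * e y)).
    exact: is_deriveN.
  rewrite (@ge0_continuous_FTC2y _ _ (fun y => - (y * e y)) 1 0)//.
  - by rewrite mul1r EFinN sub0e oppeK.
  - move=> y y1; rewrite -mulNr opprB.
    by apply: mulr_ge0; [rewrite subr_ge0 exprn_ege1|exact: ltW].
  - apply: continuous_subspaceT => y; apply: cvgN; apply: cvgM; last exact: continuous_e.
    by apply: cvgB; [exact: cvg_cst|exact: continuous_sqr].
  - by rewrite -oppr0; apply: cvgN; exact: cvg_ye.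
  - apply: cvg_at_right_filter; apply: cvgN; apply: cvgM; [exact: cvg_id|exact: continuous_e].
  - by move=> y _; rewrite derive1E; case: (d y).
rewrite -ge0_integralD//.
- by apply: eq_integral => y _; rewrite -EFinD; congr EFin; rewrite /se; ring.
- by move=> y _; rewrite lee_fin ltW.
- exact: measurable_e.
- move=> y /=; rewrite in_itv/= andbT => y1.
  rewrite lee_fin -mulNr opprB.
  by apply: mulr_ge0; [rewrite subr_ge0 exprn_ege1|exact: ltW].
- apply/measurable_EFinP; apply: measurableT_comp => //.
  apply: measurable_funM; last by apply/measurable_EFinP; exact: measurable_e.
  by apply: measurable_funB => //; exact: measurable_funX.
Qed.

Let integral_half (f : R -> R) : (forall y, 0 <= f y) -> continuous f ->
  f =1 f \o -%R ->
  (\int[mu]_y (f y)%:E = 2%:E * (\int[mu]_(y in `[0%R, 1%R]) (f y)%:E +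
                              \int[mu]_(y in `[1%R, +oo[) (f y)%:E))%E.
Proof.
move=> f0 cf fN; rewrite ge0_symfun_integralT// -set_itvcy; congr (_ * _)%E.
have mf D : measurable_fun D (EFin \o f).
  by apply/measurable_EFinP; apply: measurable_funTS; exact: continuous_measurable_fun.
have -> : `[0%R, +oo[%classic = `[0%R, 1%R] `|` `]1%R, +oo[ :> set R.
  by apply: itv_bndbnd_setU; rewrite bnd_simp.
rewrite ge0_integral_setU//=.
- by rewrite [in LHS]integral_itv_obnd_cbnd//; exact: mf.
- exact: mf.
- by move=> y _; rewrite lee_fin.
- rewrite disj_set2E; apply/eqP; rewrite -subset0 => y [] /=; rewrite !in_itv/=.
  by move=> /andP[_ y1]; rewrite andbT ltNge y1.
Qed.

Lemma normal_second_moment : (\int[mu]_y (y ^+ 2 * phi y)%:E = 1)%E.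
Proof.
have integral_phi := @integral_normal_pdf R 0 1.
have pk0 : 0 <= normal_peak (1 : R) by exact: normal_peak_ge0.
have eN y : e y = e (- y) by rewrite /e sqrrN.
have seN y : se y = se (- y) by rewrite /se sqrrN eN.
have ie : ((normal_peak (1 : R))%:E * \int[mu]_y (e y)%:E = 1)%E.
  rewrite -integral_phi -ge0_integralZl_EFin//; last 2 first.
  - by move=> y _; rewrite lee_fin ltW.
  - exact: measurable_e.
  by apply: eq_integral => y _; rewrite normal_pdf_e EFinM.
have -> : (\int[mu]_y (y ^+ 2 * phi y)%:E =
    (normal_peak (1 : R))%:E * \int[mu]_y (se y)%:E)%E.
  rewrite -ge0_integralZl_EFin//; last 2 first.
  - by move=> y _; rewrite lee_fin.
  - exact: measurable_se.
  by apply: eq_integral => y _; rewrite normal_pdf_e -EFinM /se; congr EFin; ring.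
rewrite -[RHS]ie; congr (_ * _)%E.
rewrite !integral_half//; last by move=> y; exact: ltW.
rewrite integral_se_left integral_se_right; congr (_ * _)%E.
by rewrite -addeA [((e 1)%:E + _)%E]addeC.
Qed.

End normal_second_moment.

Section normal_absolute_moments.
Context {R : realType}.
Local Notation mu := (@lebesgue_measure R).
Local Notation phi := (@normal_pdf R 0 1).
Variables (gamma : R) (gamma_gt0 : 0 < gamma).

Let G (x : R) := x `^ gamma * expR (- (x ^+ 2 / 2)).
Let H (u : R) := u `^ ((gamma + 1) / 2 - 1) * expR (- u).

Let G_ge0 x : 0 <= G x. Proof. by rewrite mulr_ge0 ?powR_ge0 ?expR_ge0. Qed.
Let H_ge0 x : 0 <= H x. Proof. by rewrite mulr_ge0 ?powR_ge0 ?expR_ge0. Qed.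

Let measurable_G : measurable_fun setT G.
Proof.
apply: measurable_funM; first exact: measurable_powR.
apply: measurableT_comp => //; apply: measurableT_comp => //.
by apply: measurable_funM => //; exact: measurable_funX.
Qed.

Let measurable_H : measurable_fun setT H.
Proof.
apply: measurable_funM; first exact: measurable_powR.
by apply: measurableT_comp => //; exact: measurableT_comp.
Qed.

Let cvg_powR (a x : R) : 0 < x -> {for x, continuous (fun y => y `^ a)}.
Proof.
move=> x0; apply: differentiable_continuous; apply/derivable1_diffP.
by have [] := is_derive1_powR a x0.
Qed.

Let continuous_G (x : R) : 0 < x -> {for x, continuous G}.
Proof.
move=> x0; apply: cvgM; first exact: cvg_powR.
apply: continuous_comp; last exact: continuous_expR.
apply: cvgN; apply: cvgM; last exact: cvg_cst.
exact: exprn_continuous.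
Qed.

(** The substitution x = F u turns the Gaussian weight into the weight of the
    Gamma integral. *)
Let F (u : R) : R := Num.sqrt 2 * Num.sqrt u.

Let is_derive_F (u : R) : 0 < u -> is_derive u 1 F (Num.sqrt 2 / (2 * Num.sqrt u)).
Proof.
move=> u0; have h := is_derive1_sqrt u0.
exact: is_derive_eq.
Qed.

Let dF_E (u : R) : 0 < u -> F^`()%classic u = Num.sqrt 2 / (2 * Num.sqrt u).
Proof. by move=> u0; have h := is_derive_F u0; rewrite derive1E derive_val. Qed.

Let cvg_dF (u : R) : 0 < u -> F^`()%classic @ u --> Num.sqrt 2 / (2 * Num.sqrt u).
Proof.
move=> u0.
have h : Num.sqrt 2 / (2 * Num.sqrt y) @[y --> u] --> Num.sqrt 2 / (2 * Num.sqrt u).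
  apply: cvgM; first exact: cvg_cst.
  apply: cvgV; first by rewrite mulf_neq0// gt_eqF// sqrtr_gt0.
  by apply: cvgM; [exact: cvg_cst|exact: sqrt_continuous].
apply: cvg_trans h; apply: near_eq_cvg; near=> y.
by rewrite dF_E; last by near: y; exact: lt_nbhsr.
Unshelve. all: by end_near. Qed.

Let cvg_sqrty : Num.sqrt u @[u --> +oo] --> (+oo : set_system R).
Proof.
apply/cvgryPge => A; near=> u.
apply: (le_trans (ler_norm A)); rewrite -sqrtr_sqr; apply: ler_wsqrtr.
by near: u; apply: nbhs_pinfty_ge; rewrite num_real.
Unshelve. all: by end_near. Qed.

Let G_F (u : R) : 0 < u -> G (F u) * (Num.sqrt 2 / (2 * Num.sqrt u)) =
  2 `^ ((gamma - 1) / 2) * H u.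
Proof.
move=> u0; have u2 : 0 <= 2 * u by rewrite mulr_ge0// ltW.
have FE : F u = (2 * u) `^ 2^-1 by rewrite powR12_sqrt// sqrtrM.
have -> : Num.sqrt 2 / (2 * Num.sqrt u) = (2 * u) `^ (- 2^-1).
  rewrite powRN -FE /F -[X in _ / (X * _)](@sqr_sqrtr _ 2)//.
  by field; rewrite !gt_eqF ?sqrtr_gt0.
rewrite /G FE -powR_mulrn ?powR_ge0// -!powRrM mulVf// powRr1//.
rewrite mulrAC -powRD; last by apply/implyP => _; rewrite gt_eqF// mulr_gt0.
rewrite powRM// ?ltW// /H.
rewrite (_ : 2 * u / 2 = u); last by field.
rewrite (_ : 2^-1 * gamma - 2^-1 = (gamma - 1) / 2); last by field.
rewrite (_ : (gamma + 1) / 2 - 1 = (gamma - 1) / 2); last by field.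
by rewrite mulrA.
Qed.

Let substitution (a : R) : 0 < a ->
  (\int[mu]_(x in `[F a, +oo[) (G x)%:E =
   (2 `^ ((gamma - 1) / 2))%:E * \int[mu]_(u in `[a, +oo[) (H u)%:E)%E.
Proof.
move=> a0; have Fa0 : 0 < F a by rewrite mulr_gt0// sqrtr_gt0.
rewrite increasing_ge0_integration_by_substitutiony//.
- rewrite -ge0_integralZl_EFin ?powR_ge0//; last 2 first.
  - by move=> u _; rewrite lee_fin.
  - by apply/measurable_EFinP; exact: measurable_funTS.
  apply: eq_integral => u; rewrite inE/= in_itv/= andbT => au.
  have u0 : 0 < u by exact: lt_le_trans au.
  by rewrite -EFinM -G_F// -dF_E.
- move=> x y; rewrite !in_itv/= !andbT => ax ay xy.
  rewrite ltr_pM2l ?sqrtr_gt0// ltr_sqrt//; apply: le_lt_trans xy.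
  by apply: le_trans ax; exact: ltW.
- move=> x; rewrite in_itv/= andbT => ax; have := cvg_dF (lt_trans a0 ax).
  by rewrite -(dF_E (lt_trans a0 ax)).
- apply/cvg_ex; exists (Num.sqrt 2 / (2 * Num.sqrt a)).
  by apply: cvg_at_right_filter; exact: cvg_dF.
- apply/cvg_ex; exists 0.
  have h : Num.sqrt 2 / 2 * (Num.sqrt y)^-1 @[y --> +oo] --> (0 : R).
    rewrite -[X in _ --> X](mulr0 (Num.sqrt 2 / 2)); apply: cvgM; first exact: cvg_cst.
    apply/gtr0_cvgV0; last exact: cvg_sqrty.
    by near=> y; rewrite sqrtr_gt0; near: y; exact: nbhs_pinfty_gt.
  apply: cvg_trans h; apply: near_eq_cvg; near=> y.
  rewrite dF_E; last by near: y; exact: nbhs_pinfty_gt.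
  by rewrite invfM mulrA.
- split => [x|]; first by rewrite in_itv/= andbT => ax; have [] := is_derive_F (lt_trans a0 ax).
  apply: cvg_at_right_filter; apply: cvgM; [exact: cvg_cst|exact: sqrt_continuous].
- by apply: gt0_cvgMry; [rewrite sqrtr_gt0|exact: cvg_sqrty].
- apply/continuous_within_itvcyP; split.
    by move=> x; rewrite in_itv/= andbT => ax; apply: continuous_G; exact: lt_trans ax.
  by apply: cvg_at_right_filter; exact: continuous_G.
Unshelve. all: by end_near. Qed.

(** F is not differentiable at 0, and G or H may be unbounded there, so the
    half-line is exhausted by intervals that stay away from 0. *)
Let half_line_exhausted (a : nat -> R) (f : R -> R) : (forall n, 0 < a n) ->
  {homo a : n m / (n <= m)%N >-> m <= n} -> a @ \oo --> 0 ->
  (forall x, 0 <= f x) -> measurable_fun setT f ->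
  (\int[mu]_(x in `[a n, +oo[) (f x)%:E @[n --> \oo] -->
   \int[mu]_(x in `]0%R, +oo[) (f x)%:E)%E.
Proof.
move=> a0 adec acvg f0 mf.
rewrite (_ : `]0%R, +oo[%classic = \bigcup_n [set` `[a n, +oo[]); last first.
  apply/seteqP; split=> [x /=|x [n _] /=]; rewrite !in_itv/= !andbT.
    move=> x0; have : \forall n \near \oo, a n <= x.
      by apply: (cvgr_le 0).
    by case=> N _ /(_ N (leqnn N)) aN; exists N => //=; rewrite in_itv/= andbT.
  exact: lt_le_trans.
apply: ge0_nondecreasing_set_cvg_integral => //.
- move=> n m nm; apply/subsetPset => x /=; rewrite !in_itv/= !andbT.
  exact/le_trans/adec.
- by move=> n; apply/measurable_EFinP; exact: measurable_funTS.
- by move=> n x _; rewrite lee_fin.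
Qed.

Let half_line_integral :
  (\int[mu]_(x in `]0%R, +oo[) (G x)%:E =
   (2 `^ ((gamma - 1) / 2))%:E * \int[mu]_(u in `]0%R, +oo[) (H u)%:E)%E.
Proof.
pose a (n : nat) : R := n.+1%:R^-1.
have a0 n : 0 < a n by rewrite invr_gt0.
have adec : {homo a : n m / (n <= m)%N >-> m <= n}.
  by move=> n m nm; rewrite lef_pV2 ?posrE// ler_nat.
have acvg : a @ \oo --> 0 by exact: cvg_harmonic.
have F0 n : 0 < F (a n) by rewrite mulr_gt0 ?sqrtr_gt0.
have Fdec : {homo F \o a : n m / (n <= m)%N >-> m <= n}.
  by move=> n m /adec nm; rewrite /= ler_pM2l ?sqrtr_gt0//; exact: ler_wsqrtr.
have Fcvg : (F \o a) n @[n --> \oo] --> 0.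
  rewrite -[X in _ --> X](mulr0 (Num.sqrt 2)); apply: cvgM; first exact: cvg_cst.
  rewrite -[X in _ --> X](sqrtr0 R); apply: cvg_comp acvg _.
  exact: sqrt_continuous.
have h1 := half_line_exhausted F0 Fdec Fcvg G_ge0 measurable_G.
have h2 := half_line_exhausted a0 adec acvg H_ge0 measurable_H.
rewrite -(cvg_lim _ h1)//; apply/cvg_lim => //.
under eq_fun do rewrite substitution//.
apply: cvgeZl => //; exact: h2.
Qed.

(** Gaussian domination, from ln x <= x and gamma x <= gamma ^ 2 + x ^ 2 / 4: it
    makes the Gamma integral finite. *)
Let G_bound x : 0 < x -> G x <= expR (gamma ^+ 2) * expR (- (x ^+ 2 / 4)).
Proof.
move=> x0; rewrite /G /powR gt_eqF// -!expRD ler_expR.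
have h : gamma * ln x <= gamma * x.
  by rewrite ler_wpM2l ?ltW//; exact: ln_sublinear.
by have := sqr_ge0 (gamma - x / 2); nra.
Qed.

Lemma normal_abs_moment : (\int[mu]_y (`|y| `^ gamma * phi y)%:E =
  (1 / Num.sqrt pi * 2 `^ (gamma / 2) * euler_gamma ((gamma + 1) / 2))%:E)%E.
Proof.
have p0 : normal_peak (1 : R) = (Num.sqrt 2 * Num.sqrt pi)^-1.
  by rewrite /normal_peak expr1n mul1r -mulr_natl sqrtrM.
have phiE y : phi y = normal_peak 1 * expR (- (y ^+ 2 / 2)).
  rewrite normal_pdfE ?oner_neq0// /normal_fun subr0 expr1n.
  by congr (_ * expR _); rewrite mulNr.
pose f y := `|y| `^ gamma * phi y.
have f0 y : 0 <= f y by rewrite mulr_ge0 ?powR_ge0 ?normal_pdf_ge0.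
have fN y : f (- y) = f y by rewrite /f normrN normal_pdfN.
have mf : measurable_fun setT f.
  apply: measurable_funM; last exact: measurable_normal_pdf.
  by apply: (measurableT_comp (measurable_powR gamma)); exact: normr_measurable.
have mfD (D : set R) : measurable_fun D (EFin \o f).
  by apply/measurable_EFinP; exact: measurable_funTS.
have mGD (D : set R) : measurable_fun D (EFin \o G).
  by apply/measurable_EFinP; exact: measurable_funTS.
have posE : (\int[mu]_(y in `]0%R, +oo[) (f y)%:E =
    (normal_peak (1 : R))%:E * \int[mu]_(y in `]0%R, +oo[) (G y)%:E)%E.
  rewrite -ge0_integralZl_EFin ?normal_peak_ge0//; last 2 first.
  - by move=> y _; rewrite lee_fin.
  - exact: mGD.
  apply: eq_integral => y; rewrite inE/= in_itv/= andbT => y0.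
  by rewrite -EFinM /f /G phiE gtr0_norm//; congr EFin; ring.
have finG : (\int[mu]_(y in `]0%R, +oo[) (G y)%:E < +oo)%E.
  pose s := Num.sqrt (2 : R).
  have s0 : s != 0 by rewrite gt_eqF// sqrtr_gt0.
  have pk : 0 < normal_peak s by rewrite normal_peak_gt0.
  pose c := expR (gamma ^+ 2) / normal_peak s.
  have c0 : 0 <= c by rewrite divr_ge0 ?expR_ge0 ?ltW.
  have mpdf (D : set R) : measurable_fun D (EFin \o normal_pdf 0 s).
    by apply/measurable_EFinP; apply: measurable_funTS; exact: measurable_normal_pdf.
  apply: (@le_lt_trans _ _ (\int[mu]_(y in `]0%R, +oo[) (c%:E * (normal_pdf 0 s y)%:E))%E).
    apply: ge0_le_integral => //.
    - by move=> y _; rewrite lee_fin.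
    - exact: mGD.
    - by apply: emeasurable_funM => //; exact: mpdf.
    - move=> y /=; rewrite in_itv/= andbT => y0; rewrite lee_fin.
      rewrite normal_pdfE// /normal_fun subr0 /c mulrA divfK ?gt_eqF//.
      apply: (le_trans (G_bound y0)); rewrite mulNr sqr_sqrtr//.
      by rewrite (_ : 2 *+ 2 = 4)//; ring.
  rewrite ge0_integralZl_EFin//; last 2 first.
  - by move=> y _; rewrite lee_fin normal_pdf_ge0.
  - exact: mpdf.
  apply: (@le_lt_trans _ _ (c%:E * \int[mu]_y (normal_pdf 0 s y)%:E)%E).
    apply: lee_wpmul2l; first by rewrite lee_fin.
    apply: ge0_subset_integral => //; first exact: mpdf.
    by move=> y _; rewrite lee_fin normal_pdf_ge0.
  by rewrite integral_normal_pdf mule1 ltry.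
have hG := half_line_integral.
have pos2 : 0 < (2 : R) `^ ((gamma - 1) / 2) by rewrite powR_gt0.
have finH : (\int[mu]_(u in `]0%R, +oo[) (H u)%:E)%E \is a fin_num.
  rewrite ge0_fin_numE; last by apply: integral_ge0 => u _; rewrite lee_fin.
  rewrite ltNge; apply/negP; rewrite leye_eq => /eqP HE.
  by move: finG; rewrite hG HE gt0_muley ?lte_fin.
have HE : (\int[mu]_(u in `]0%R, +oo[) (H u)%:E)%E = (euler_gamma ((gamma + 1) / 2))%:E.
  by rewrite /euler_gamma /Rintegral fineK.
have -> : (\int[mu]_y (f y)%:E = 2%:E * \int[mu]_(y in `]0%R, +oo[) (f y)%:E)%E.
  have -> : [set: R] = `]-oo, 0%R] `|` `]0%R, +oo[.
    by rewrite -itv_bndbnd_setU ?bnd_simp// set_itvE.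
  rewrite ge0_integral_setU//=.
  - have -> : (\int[mu]_(y in `]-oo, 0%R]) (f y)%:E =
               \int[mu]_(y in `]-oo, 0%R]) (f (- y))%:E)%E.
      by apply: eq_integral => y _; rewrite fN.
    rewrite -(@ge0_integration_by_substitution0 _ (EFin \o f))//.
    + rewrite -integral_itv_obnd_cbnd; last exact: mfD.
      by rewrite mule_natl mule2n.
  - exact: mfD.
  - by move=> y _; rewrite lee_fin.
  - rewrite disj_set2E; apply/eqP; rewrite -subset0 => y [] /=; rewrite !in_itv/=.
    by move=> y0; rewrite andbT ltNge y0.
rewrite posE hG HE -!EFinM p0; congr EFin.
rewrite (_ : (gamma - 1) / 2 = gamma / 2 - 2^-1); last by field.
rewrite powRD; last by rewrite pnatr_eq0 implybT.
rewrite powRN powR12_sqrt//.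
have s2 : (2 : R) = Num.sqrt 2 * Num.sqrt 2 by rewrite -expr2 sqr_sqrtr.
rewrite [X in X * _ = _]s2; field.
by rewrite !gt_eqF ?sqrtr_gt0 ?pi_gt0.
Qed.

End normal_absolute_moments.

(** * Square-integrable and Gaussian variables *)

Section square_integrable.
Context {d : measure_display} {Om : measurableType d} {R : realType}.
Variable P : probability Om R.
Implicit Types (X Y Z : Om -> R) (c v : R).

Definition sqint X :=
  measurable_fun setT X /\ P.-integrable setT (fun w => (X w ^+ 2)%:E).

Lemma sqintM_integrable X Y : sqint X -> sqint Y ->
  P.-integrable setT (fun w => (X w * Y w)%:E).
Proof.
move=> [mX iX] [mY iY].
apply: (@le_integrable _ _ _ P setT measurableT _
  ((fun w => (X w ^+ 2)%:E) \+ (fun w => (Y w ^+ 2)%:E))%E).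
- by apply/measurable_EFinP; exact: measurable_funM.
- move=> w _ /=; rewrite lee_fin [leRHS]ger0_norm; last first.
    by rewrite addr_ge0 ?sqr_ge0.
  by rewrite ler_norml; have := sqr_ge0 (X w + Y w); have := sqr_ge0 (X w - Y w); nra.
- exact: integrableD.
Qed.

Lemma sqint_cst c : sqint (cst c).
Proof. by split=> //; exact: (finite_measure_integrable_cst _ (c ^+ 2)). Qed.

Lemma sqint_integrable X : sqint X -> P.-integrable setT (EFin \o X).
Proof.
move=> sX; have := sqintM_integrable sX (sqint_cst 1).
by under eq_fun do rewrite mulr1.
Qed.

Lemma sqintZ c X : sqint X -> sqint (fun w => c * X w).
Proof.
move=> [mX iX]; split; first exact: measurable_funM.
under eq_fun do rewrite exprMn EFinM.
exact: integrableZl.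
Qed.

Lemma sqintD X Y : sqint X -> sqint Y -> sqint (fun w => X w + Y w).
Proof.
move=> sX sY; split; first by apply: measurable_funD; [case: sX|case: sY].
have sXY := sqintM_integrable sX sY; case: sX sY => [mX iX] [mY iY].
rewrite (_ : (fun w => _) = (fun w => (X w ^+ 2)%:E + (2 * (X w * Y w))%:E + (Y w ^+ 2)%:E)%E).
  apply: integrableD => //; apply: integrableD => //.
  under eq_fun do rewrite EFinM.
  exact: integrableZl.
by apply/funext => w; rewrite -!EFinD; congr EFin; ring.
Qed.

Lemma sqint_sum n (X : 'I_n -> Om -> R) : (forall i, sqint (X i)) ->
  sqint (fun w => \sum_(i < n) X i w).
Proof.
elim: n X => [|n IH] X sX.
  by under eq_fun do rewrite big_ord0; exact: sqint_cst.
under eq_fun do rewrite big_ord_recr.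
by apply: sqintD => //; exact: IH.
Qed.

Lemma Rint_add X Y : P.-integrable setT (EFin \o X) -> P.-integrable setT (EFin \o Y) ->
  \int[P]_w (X w + Y w) = \int[P]_w X w + \int[P]_w Y w.
Proof. by move=> iX iY; rewrite RintegralD. Qed.

Lemma Rint_scale c X : P.-integrable setT (EFin \o X) ->
  \int[P]_w (c * X w) = c * \int[P]_w X w.
Proof. by move=> iX; rewrite RintegralZl. Qed.

Lemma Rint_cst c : \int[P]_w c = c.
Proof. by rewrite Rintegral_cst// [X in fine X]probability_setT /= mulr1. Qed.

Lemma ae_eq_Rint X Y : measurable_fun setT X -> measurable_fun setT Y ->
  {ae P, forall w, X w = Y w} -> \int[P]_w X w = \int[P]_w Y w.
Proof.
move=> mX mY XY; congr fine; apply: ae_eq_integral => //.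
- exact/measurable_EFinP.
- exact/measurable_EFinP.
- by case: XY => N [mN N0 NP]; exists N; split=> // w /= h; apply: NP => /= e;
    apply: h => _; rewrite e.
Qed.

Lemma Rint_EFin X : P.-integrable setT (EFin \o X) ->
  (\int[P]_w (X w)%:E = (\int[P]_w X w)%:E)%E.
Proof. by move=> iX; rewrite /Rintegral fineK// integrable_fin_num. Qed.

Lemma ge0_integral_same_law X Y (G : R -> R) :
  measurable_fun setT X -> measurable_fun setT Y ->
  (forall A, measurable A -> P (X @^-1` A) = P (Y @^-1` A)) ->
  measurable_fun setT G -> (forall x, 0 <= G x) ->
  (\int[P]_w (G (X w))%:E = \int[P]_w (G (Y w))%:E)%E.
Proof.
move=> mX mY XY mG G0; have mGE : measurable_fun setT (EFin \o G) by exact/measurable_EFinP.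
transitivity (\int[pushforward P X]_x (EFin \o G) x)%E.
  by rewrite (ge0_integral_pushforward mX)// => x _; rewrite lee_fin.
transitivity (\int[pushforward P Y]_x (EFin \o G) x)%E.
  by apply: eq_measure_integral => A mA _; exact: XY.
by rewrite (ge0_integral_pushforward mY)// => x _; rewrite lee_fin.
Qed.

Lemma Rint_cos_same_law X Y b :
  measurable_fun setT X -> measurable_fun setT Y ->
  (forall A, measurable A -> P (X @^-1` A) = P (Y @^-1` A)) ->
  \int[P]_w cos (X w + b) = \int[P]_w cos (Y w + b).
Proof.
move=> mX mY XY; pose G x := 1 + cos (x + b).
have icos Z : measurable_fun setT Z ->
    P.-integrable setT (EFin \o (fun w => cos (Z w + b))).
  move=> mZ; apply: bounded_rv_integrable; apply: bounded_rv_cos.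
  exact: measurable_funD.
have i1 : P.-integrable setT (EFin \o cst 1).
  exact: finite_measure_integrable_cst.
have mG : measurable_fun setT G.
  apply: measurable_funD => //.
  apply: (measurableT_comp (continuous_measurable_fun (@continuous_cos R))).
  exact: measurable_funD.
have G0 x : 0 <= G x by rewrite /G; have := cos_geN1 (x + b); lra.
have /(congr1 fine) := ge0_integral_same_law mX mY XY mG G0.
rewrite -/(Rintegral _ _ (fun w => 1 + cos (X w + b))).
rewrite -/(Rintegral _ _ (fun w => 1 + cos (Y w + b))).
by rewrite !Rint_add//; [exact: addrI|exact: icos|exact: icos].
Qed.

(** The first two moments of a Gaussian law give back its two parameters; a null
    second moment is the degenerate case. *)
Lemma gaussian_law X v : gaussian P X -> sqint X ->
  \int[P]_w X w = 0 -> \int[P]_w (X w ^+ 2) = v ->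
  forall A, measurable A ->
  P (X @^-1` A) = if v == 0 then \d_(0 : R) A else normal_prob 0 (Num.sqrt v) A.
Proof.
move=> [m [s [s0 lawX]]] sX EX EX2 A mA; have [mX iX2] := sX.
have iX := sqint_integrable sX.
rewrite lawX//; have [s00|sn0] := eqVneq s 0.
  have Xm : {ae P, forall w, X w = m}.
    exists (X @^-1` (~` [set m])); split => //.
    - by rewrite -[X in measurable X]setTI; apply: mX => //; exact: measurableC.
    - rewrite lawX ?s00 ?eqxx; last exact: measurableC.
      by rewrite diracE memNset// => /(_ erefl).
  have m0 : m = 0.
    by rewrite -EX -[LHS]Rint_cst; apply: ae_eq_Rint => //; case: Xm => N [? ? h];
      exists N; split=> // w /= e; apply: h => /= e'; apply: e.
  have -> : v = 0; last by rewrite eqxx m0.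
  rewrite -EX2 -[RHS]Rint_cst; apply: ae_eq_Rint => //; first exact: measurable_funX.
  case: Xm => N [? ? h]; exists N; split=> // w /= e; apply: h => /= e'.
  by apply: e; rewrite e' m0 expr0n.
have s1 : 0 < s by rewrite lt_neqAle eq_sym sn0.
have lawN B : measurable B -> P (X @^-1` B) = normal_prob m s B.
  by move=> mB; rewrite lawX// (negbTE sn0).
pose Z w := s^-1 * (X w + - m).
have sZ : sqint Z by apply: sqintZ; apply: sqintD => //; exact: sqint_cst.
have ZE w : (X w - m) / s = Z w by rewrite /Z mulrC.
have EZ : \int[P]_w Z w = 0.
  have mp (f : R -> R) : measurable_fun setT f -> measurable_fun setT (fun y => Num.max (f y) 0).
    by move=> mf; exact: measurable_maxr.
  have mx0 (y : R) : 0 <= Num.max y 0 by rewrite le_max lexx orbT.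
  (* the positive and the negative part of Z have the same expectation *)
  have h : \int[P]_w Num.max (Z w) 0 = \int[P]_w Num.max (- Z w) 0.
    congr fine; transitivity (\int[lebesgue_measure]_y (Num.max (y : R) 0 * normal_pdf 0 1 y)%:E)%E.
      rewrite -(ge0_expectation_normal s1 mX lawN
        (mp id (@measurable_id _ _ setT)) (fun y => mx0 y)).
      by apply: eq_integral => w _; rewrite /= ZE.
    rewrite integral_normal_pos_neg.
    rewrite -(ge0_expectation_normal s1 mX lawN
      (mp -%R (@oppr_measurable R setT)) (fun y => mx0 (- y))).
    by apply: eq_integral => w _; rewrite /= ZE.
  have imax (f : Om -> R) : P.-integrable setT (EFin \o f) ->
      P.-integrable setT (EFin \o (fun w => Num.max (f w) 0)).
    move=> jf; apply: (le_integrable measurableT _ _ jf) => //.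
      apply/measurable_EFinP; apply: measurable_maxr => //.
      by apply/measurable_EFinP; exact: measurable_int jf.
    move=> w _ /=; rewrite lee_fin (ger0_norm (mx0 _)) ge_max ler_norm normr_ge0//.
  have -> : \int[P]_w Z w = \int[P]_w (Num.max (Z w) 0 - Num.max (- Z w) 0).
    apply: eq_Rintegral => w _; rewrite /Num.max.
    by case: ifP => h3; case: ifP => h4; lra.
  have iZ := sqint_integrable sZ.
  have iNZ : P.-integrable setT (EFin \o (fun w => - Z w)).
    have := sqint_integrable (sqintZ (-1) sZ).
    by rewrite (_ : (fun w => -1 * Z w) = (fun w => - Z w))//; apply/funext => w; rewrite mulN1r.
  rewrite RintegralB//; [|exact: imax|exact: imax].
  by rewrite h subrr.
have EZm : s^-1 * (0 - m) = 0.
  have e1 : \int[P]_w Z w = s^-1 * \int[P]_w (X w + - m).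
    by apply: Rint_scale; exact: sqint_integrable (sqintD sX (sqint_cst (- m))).
  have e2 : \int[P]_w (X w + - m) = 0 - m.
    rewrite (@Rint_add X (cst (- m)))// ?EX ?Rint_cst//.
    exact: sqint_integrable (sqint_cst (- m)).
  by rewrite -e2 -e1.
have m0 : m = 0.
  by move/eqP: EZm; rewrite mulf_eq0 invr_eq0 (negbTE sn0) /= sub0r oppr_eq0 => /eqP.
have vs : v = s ^+ 2.
  have h : \int[P]_w ((X w - m) / s) ^+ 2 = 1.
    rewrite -[RHS]/(fine 1%E) -(@normal_second_moment R); congr fine.
    exact: (ge0_expectation_normal s1 mX lawN (@exprn_measurable R setT 2) (fun y => sqr_ge0 y)).
  have e : \int[P]_w ((X w - m) / s) ^+ 2 = \int[P]_w ((s ^+ 2)^-1 * X w ^+ 2).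
    by apply: eq_Rintegral => w _; rewrite m0 subr0 exprMn mulrC exprVn.
  rewrite e Rint_scale// EX2 in h.
  by rewrite -[LHS](mulVKf (x := s ^+ 2)) ?sqrf_eq0// h mulr1.
by rewrite vs sqrf_eq0 (negbTE sn0) sqrtr_sqr ger0_norm// m0.
Qed.

End square_integrable.

(** * Second-order structure of fractional Brownian motion *)

Section covariance_function.
Context {d : measure_display} {Om : measurableType d} {R : realType}.
Variables (P : probability Om R) (H : R) (B : R -> {RV P >-> R}).
Hypothesis fB : fractional_brownian_motion P H B.
Implicit Types (s t : R).

Let H_gt0 : 0 < H. Proof. by have /andP[] := fbm_hurst _ _ _ fB. Qed.

Lemma fbm_measurable t : measurable_fun setT (B t).
Proof. exact: measurable_funPT. Qed.

Lemma fbm_mean t : 0 <= t -> \int[P]_w B t w = 0.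
Proof. by move=> t0; have := fbm_centered _ _ _ fB _ t0; rewrite unlock /Rintegral => ->. Qed.

Let fbm_square_EFin t : 0 <= t -> (\int[P]_w (B t w ^+ 2)%:E = (t `^ (2 * H))%:E)%E.
Proof.
move=> t0; rewrite -(fbm_variance _ _ _ fB _ t0) /variance covariance.unlock.
rewrite (fbm_centered _ _ _ fB _ t0) expectation.unlock /=.
by apply: eq_integral => w _; rewrite -[in LHS](subr0 (B t w)) expr2.
Qed.

Lemma fbm_sqint t : 0 <= t -> sqint P (B t).
Proof.
move=> t0; split; first exact: fbm_measurable.
apply/integrableP; split.
  by apply/measurable_EFinP; apply: measurable_funX; exact: fbm_measurable.
under eq_integral do rewrite /= ger0_norm ?sqr_ge0//.
by rewrite fbm_square_EFin// ltry.
Qed.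

Lemma fbm_square t : 0 <= t -> \int[P]_w (B t w ^+ 2) = t `^ (2 * H).
Proof. by move=> t0; rewrite /Rintegral fbm_square_EFin. Qed.

Lemma Rint_square_eq0 (X : Om -> R) : sqint P X -> \int[P]_w (X w ^+ 2) = 0 ->
  {ae P, forall w, X w = 0}.
Proof.
move=> [mX iX] X0.
have mX2 : measurable_fun setT (fun w => (X w ^+ 2)%:E).
  by apply/measurable_EFinP; exact: measurable_funX.
have [+ _] := @ae_eq_integral_abs _ _ _ P setT measurableT _ mX2.
case.
  rewrite (_ : (\int[P]_w _)%E = (\int[P]_w (X w ^+ 2)%:E)%E).
    by rewrite (Rint_EFin (X := fun w => X w ^+ 2))// X0.
  by apply: eq_integral => w _; rewrite /= ger0_norm ?sqr_ge0.
move=> N [mN N0 h]; exists N; split=> // w /= Xn; apply: h => /= /(_ I) [] /eqP.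
by rewrite sqrf_eq0 => /eqP.
Qed.

Lemma fbm_start : {ae P, forall w, B 0 w = 0}.
Proof.
apply: Rint_square_eq0; first exact: fbm_sqint.
by rewrite fbm_square// powR0// mulf_neq0 ?gt_eqF.
Qed.

(** By stationarity the increment has the law of B (t - s) - B 0, and B 0 vanishes
    almost surely because its variance does. *)
Lemma fbm_increment s t : 0 <= s -> s <= t ->
  \int[P]_w ((B t w - B s w) ^+ 2) = (t - s) `^ (2 * H).
Proof.
move=> s0 st; have h0 : 0 <= t - s by rewrite subr_ge0.
rewrite -(fbm_square h0).
have mB u v : measurable_fun setT (fun w => B u w - B v w).
  by apply: measurable_funB; exact: fbm_measurable.
transitivity (\int[P]_w ((B (t - s) w - B 0 w) ^+ 2)).
  congr fine; apply: (ge0_integral_same_law (mB _ _) (mB _ _) _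
    (@exprn_measurable R setT 2) (@sqr_ge0 R)).
  move=> A mA.
  have := fbm_stationary _ _ _ fB s 1 (fun=> t - s) s0 (fun=> h0)
    [set x | A (tnth x ord0)].
  rewrite (_ : [set w | _] = (fun w => B t w - B s w) @^-1` A); last first.
    by apply/seteqP; split => w /=; rewrite tnth_mktuple (_ : s + (t - s) = t)//; ring.
  rewrite (_ : [set w | [set x | A (tnth x ord0)] _] =
    (fun w => B (t - s) w - B 0 w) @^-1` A); last first.
    by apply/seteqP; split => w /=; rewrite tnth_mktuple.
  apply; rewrite -[X in measurable X]setTI.
  exact: (measurable_tnth ord0).
apply: ae_eq_Rint.
- exact: measurable_funX.
- by apply: measurable_funX; exact: fbm_measurable.
- case: fbm_start => N [mN N0 h]; exists N; split=> // w /= e; apply: h => /= e'.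
  by apply: e; rewrite e' subr0.
Qed.

Lemma fbm_covariance s t : 0 <= s -> s <= t ->
  \int[P]_w (B s w * B t w) =
  (s `^ (2 * H) + t `^ (2 * H) - (t - s) `^ (2 * H)) / 2.
Proof.
move=> s0 st; have t0 := le_trans s0 st.
have [ss stt] := (fbm_sqint s0, fbm_sqint t0).
have ist := sqintM_integrable ss stt.
have e : \int[P]_w ((B t w - B s w) ^+ 2) =
    \int[P]_w (B t w ^+ 2) + (\int[P]_w (B s w ^+ 2) + (- 2) * \int[P]_w (B s w * B t w)).
  have i4 : P.-integrable setT (EFin \o (fun w => - 2 * (B s w * B t w))).
    by rewrite (_ : EFin \o _ = (fun w => (- 2)%:E * (B s w * B t w)%:E)%E)//; exact: integrableZl.
  have i5 : P.-integrable setT (EFin \o (fun w => B s w ^+ 2 + - 2 * (B s w * B t w))).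
    by case: ss => _ i3; exact: (integrableD measurableT i3 i4).
  rewrite -Rint_scale// -Rint_add//; last by case: ss.
  rewrite -Rint_add//; last by case: stt.
  by apply: eq_Rintegral => w _; ring.
move: e; rewrite fbm_increment// !fbm_square// => e.
by rewrite e; field.
Qed.

End covariance_function.

(** * The discrete reflection identity *)

Section brownian_reflection.
Context {d : measure_display} {Om : measurableType d} {R : realType}.
Variables (P : probability Om R) (B : R -> {RV P >-> R}).
Hypothesis fB : fractional_brownian_motion P (1 / 2) B.
Implicit Types (s t r T : R).

Let two_half : 2 * (1 / 2) = 1 :> R. Proof. by field. Qed.

Lemma brownian_covariance s t : 0 <= s -> s <= t -> \int[P]_w (B s w * B t w) = s.
Proof.
move=> s0 st; rewrite (fbm_covariance fB)// two_half !powRr1 ?subr_ge0//.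
  by field.
exact: le_trans st.
Qed.

Lemma Rint_cos_gaussian (X Y : Om -> R) b :
  gaussian P X -> gaussian P Y -> sqint P X -> sqint P Y ->
  \int[P]_w X w = 0 -> \int[P]_w Y w = 0 ->
  \int[P]_w (X w ^+ 2) = \int[P]_w (Y w ^+ 2) ->
  \int[P]_w cos (X w + b) = \int[P]_w cos (Y w + b).
Proof.
move=> gX gY sX sY X0 Y0 XY; apply: Rint_cos_same_law; [by case: sX|by case: sY|].
by move=> A mA; rewrite (gaussian_law gX sX X0 XY)// (gaussian_law gY sY Y0 erefl).
Qed.

Lemma fbm_combination_sqint n (t a : 'I_n -> R) : (forall i, 0 <= t i) ->
  sqint P (fun w => \sum_(i < n) a i * B (t i) w).
Proof.
by move=> t0; apply: sqint_sum => i; apply: sqintZ; exact: (fbm_sqint fB).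
Qed.

Lemma fbm_combination_mean n (t a : 'I_n -> R) : (forall i, 0 <= t i) ->
  \int[P]_w (\sum_(i < n) a i * B (t i) w) = 0.
Proof.
elim: n t a => [|n IH] t a t0; first by under eq_Rintegral do rewrite big_ord0; exact: Rint_cst.
under eq_Rintegral do rewrite big_ord_recr /=.
rewrite Rint_add ?IH// ?add0r; last 2 first.
- apply: sqint_integrable; exact: (fbm_combination_sqint (fun i => a (widen_ord (leqnSn n) i))).
- by apply: sqint_integrable; apply: sqintZ; exact: (fbm_sqint fB).
rewrite Rint_scale ?(fbm_mean fB)// ?mulr0//.
by apply: sqint_integrable; exact: (fbm_sqint fB).
Qed.

Lemma brownian_increment_orthogonal n (u a : 'I_n -> R) r T :
  (forall j, 0 <= u j <= r) -> r <= T ->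
  \int[P]_w ((\sum_(j < n) a j * B (u j) w) * (B T w - B r w)) = 0.
Proof.
move=> ur rT; elim: n u a ur => [|n IH] u a ur.
  by under eq_Rintegral do rewrite big_ord0 mul0r; exact: Rint_cst.
have /andP[u0 u1] := ur ord_max.
have r0 := le_trans u0 u1; have T0 := le_trans r0 rT.
have sW : sqint P (fun w => B T w - B r w).
  rewrite (_ : (fun w => _) = (fun w => B T w + (-1) * B r w)).
    by apply: sqintD; [|apply: sqintZ]; exact: (fbm_sqint fB).
  by apply/funext => w; rewrite mulN1r.
under eq_Rintegral do rewrite big_ord_recr /= mulrDl.
rewrite Rint_add ?IH ?add0r//; last 2 first.
- apply: sqintM_integrable => //.
  by apply: (fbm_combination_sqint (fun i => a (widen_ord (leqnSn n) i))) => i;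
    case/andP: (ur (widen_ord (leqnSn n) i)).
- by apply: sqintM_integrable => //; apply: sqintZ; exact: (fbm_sqint fB).
have su := fbm_sqint fB u0; have sT := fbm_sqint fB T0; have sr := fbm_sqint fB r0.
transitivity (\int[P]_w (a ord_max * (B (u ord_max) w * B T w - B (u ord_max) w * B r w))).
  by apply: eq_Rintegral => w _; ring.
rewrite Rint_scale; last first.
  exact: (integrableB measurableT (sqintM_integrable su sT) (sqintM_integrable su sr)).
rewrite RintegralB//; [|exact: sqintM_integrable|exact: sqintM_integrable].
by rewrite !brownian_covariance ?subrr ?mulr0// (le_trans u1).
Qed.

(** After time r the path may be reflected about its value at r without changing
    the joint law with the past.  Every linear combination C + a W of the
    variables, where W is the increment of B between r and T, becomes C - a W;
    both are centered Gaussian, with the same variance because W is orthogonal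
    to the past. *)
Lemma brownian_reflection n (u : nat -> R) r T (phi : nat -> R -> R) (psi : R -> R) :
  (forall j, (j < n)%N -> 0 <= u j <= r) -> 0 <= r -> r <= T ->
  (forall j, trig_limit (phi j)) -> trig_limit psi ->
  \int[P]_w (\prod_(j < n) phi j (B (u j) w) * psi (B T w)) =
  \int[P]_w (\prod_(j < n) phi j (B (u j) w) * psi (2 * B r w - B T w)).
Proof.
move=> ur r0 rT tphi tpsi; have T0 := le_trans r0 rT.
pose X (j : nat) w := if j == n then B T w else B (u j) w.
pose X' (j : nat) w := if j == n then 2 * B r w - B T w else B (u j) w.
pose ph (j : nat) := if j == n then psi else phi j.
have mX j : measurable_fun setT (X j) by rewrite /X; case: eqP => _; exact: fbm_measurable.
have mX' j : measurable_fun setT (X' j).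
  rewrite /X'; case: eqP => _; last exact: fbm_measurable.
  by apply: measurable_funB; [apply: measurable_funM|]=> //; exact: fbm_measurable.
have tph j : trig_limit (ph j) by rewrite /ph; case: eqP.
have joint := @trig_limit_joint _ _ _ P n.+1 X X' ph mX mX' tph.
have prodE (Y : nat -> Om -> R) (Z : Om -> R) w :
    (forall j, (j < n)%N -> Y j w = B (u j) w) -> Y n w = Z w ->
    \prod_(j < n.+1) ph j (Y j w) = \prod_(j < n) phi j (B (u j) w) * psi (Z w).
  move=> Yj Yn; rewrite big_ord_recr /= {2}/ph eqxx Yn; congr (_ * _).
  by apply: eq_bigr => j _; rewrite /ph ltn_eqF// Yj.
have prodX w : \prod_(j < n.+1) ph j (X j w) = \prod_(j < n) phi j (B (u j) w) * psi (B T w).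
  by apply: prodE => [j jn|]; rewrite /X ?eqxx// ltn_eqF.
have prodX' w : \prod_(j < n.+1) ph j (X' j w) =
    \prod_(j < n) phi j (B (u j) w) * psi (2 * B r w - B T w).
  by apply: (prodE _ (fun w => 2 * B r w - B T w)) => [j jn|]; rewrite /X' ?eqxx// ltn_eqF.
under eq_Rintegral do rewrite -prodX.
under [RHS]eq_Rintegral do rewrite -prodX'.
apply: joint => a b.
pose A w := \sum_(j < n) a j * B (u j) w.
have sumX w : \sum_(j < n.+1) a j * X j w = A w + a n * B T w.
  rewrite big_ord_recr /= {2}/X eqxx; congr (_ + _).
  by apply: eq_bigr => j _; rewrite /X ltn_eqF.
have sumX' w : \sum_(j < n.+1) a j * X' j w = A w + 2 * a n * B r w + - a n * B T w.
  rewrite big_ord_recr /= {2}/X' eqxx -addrA; congr (_ + _); last by ring.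
  by apply: eq_bigr => j _; rewrite /X' ltn_eqF.
under eq_Rintegral do rewrite sumX.
under [RHS]eq_Rintegral do rewrite sumX'.
(* both variables are combinations of B at the times u j, r and T *)
pose v (j : 'I_n.+2) := if j == n :> nat then r else if j == n.+1 :> nat then T else u j.
pose comb c e (j : 'I_n.+2) := if j == n :> nat then c else if j == n.+1 :> nat then e else a j.
have v0 j : 0 <= v j.
  rewrite /v; case: eqP => // /eqP jn; case: eqP => // /eqP jn1.
  have /ur/andP[]// : (j < n)%N.
  have := ltn_ord j; rewrite ltnS leq_eqVlt (negbTE jn1) /= ltnS leq_eqVlt.
  by rewrite (negbTE jn).
have combE c e w : \sum_(j < n.+2) comb c e j * B (v j) w = A w + c * B r w + e * B T w.
  rewrite 2!big_ord_recr /= /comb /v /= eqxx (gtn_eqF (ltnSn n)) eqxx; congr (_ + _ + _).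
  by apply: eq_bigr => j _; rewrite /= ltn_eqF// ltn_eqF// ltnS ltnW.
have gc c e : gaussian P (fun w => A w + c * B r w + e * B T w).
  rewrite (_ : (fun w => _) = (fun w => \sum_(j < n.+2) comb c e j * B (v j) w)).
    exact: (fbm_gaussian _ _ _ fB).
  by apply/funext => w; rewrite combE.
have sc c e : sqint P (fun w => A w + c * B r w + e * B T w).
  rewrite (_ : (fun w => _) = (fun w => \sum_(j < n.+2) comb c e j * B (v j) w)).
    exact: fbm_combination_sqint.
  by apply/funext => w; rewrite combE.
have mc c e : \int[P]_w (A w + c * B r w + e * B T w) = 0.
  under eq_Rintegral do rewrite -combE.
  exact: fbm_combination_mean.
have -> : \int[P]_w cos (A w + a n * B T w + b) =
    \int[P]_w cos ((A w + 0 * B r w + a n * B T w) + b).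
  by apply: eq_Rintegral => w _; rewrite mul0r addr0.
apply: Rint_cos_gaussian => //.
have := @brownian_increment_orthogonal n.+1
  (fun j => if j == n :> nat then r else u j) (fun j => if j == n :> nat then a n else a j) r T.
have CE w : \sum_(j < n.+1) (if j == n :> nat then a n else a j) *
    B (if j == n :> nat then r else u j) w = A w + a n * B r w.
  rewrite big_ord_recr /= eqxx; congr (_ + _).
  by apply: eq_bigr => j _; rewrite /= ltn_eqF.
under eq_Rintegral do rewrite CE.
move=> orth; apply/eqP; rewrite -subr_eq0 -RintegralB//;
  [|by case: (sc 0 (a n))|by case: (sc (2 * a n) (- a n))].
apply/eqP; transitivity (\int[P]_w (4 * a n * ((A w + a n * B r w) * (B T w - B r w)))).
  by apply: eq_Rintegral => w _; ring.
rewrite Rint_scale ?orth ?mulr0//.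
- move=> j; case: eqP => [_|/eqP jn]; first by rewrite r0 lexx.
  by apply: ur; have := ltn_ord j; rewrite ltnS leq_eqVlt (negbTE jn).
- apply: sqintM_integrable.
    have := sc (a n) 0; rewrite (_ : (fun w => _) = (fun w => A w + a n * B r w))//.
    by apply/funext => w; rewrite mul0r addr0.
  rewrite (_ : (fun w => _) = (fun w => B T w + (-1) * B r w)).
    by apply: sqintD; [|apply: sqintZ]; exact: (fbm_sqint fB).
  by apply/funext => w; rewrite mulN1r.
Qed.

End brownian_reflection.

(** * Path suprema along grids *)

Section path_supremum.
Context {R : realType}.
Variables (f : R -> R) (T : R).
Hypotheses (T_gt0 : 0 < T) (cf : {within `[0, +oo[, continuous f}).

Lemma path_uniform_continuity e : 0 < e -> exists2 del, 0 < del &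
  forall s t, 0 <= s <= T -> 0 <= t <= T -> `|s - t| <= del -> `|f s - f t| < e.
Proof.
move=> e0; have e2 : 0 < e / 2 by rewrite divr_gt0.
have local x : 0 <= x -> exists2 eta, 0 < eta &
    forall y, 0 <= y -> `|x - y| < eta -> `|f x - f y| < e / 2.
  move=> x0; have /subspace_continuousP/(_ x) := cf.
  rewrite /= in_itv/= andbT => /(_ x0) /cvgrPdist_lt /(_ _ e2).
  move=> /nbhs_ballP[eta /= eta0 h]; exists eta => // y y0 xy.
  by apply: h => //=; rewrite in_itv/= andbT.
have [cov _] := compact_near_coveringP `[0, T]%classic.
have := cov (@segment_compact R 0 T) R (nbhs (0 : R)^'+)
  (fun del s => 0 <= s <= T -> forall t, 0 <= t <= T ->
    `|s - t| <= del -> `|f s - f t| < e) _.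
case.
  move=> x /=; rewrite in_itv/= => /andP[x0 xT].
  have [eta eta0 h] := local x x0.
  exists (ball x (eta / 2), [set del | del < eta / 2]).
    split; first by apply: nbhsx_ballx; rewrite divr_gt0.
    by apply: nbhs_right_lt; rewrite divr_gt0.
  move=> [y del] [/= xy dl] /andP[y0 _] t /andP[t0 _] yt.
  have xy' : `|x - y| < eta / 2 by [].
  have fy : `|f x - f y| < e / 2 by apply: h => //; lra.
  have ft : `|f x - f t| < e / 2.
    apply: h => //; rewrite (_ : x - t = (x - y) + (y - t)); last by ring.
    by apply: le_lt_trans (ler_normD _ _) _; lra.
  rewrite (_ : f y - f t = (f x - f t) - (f x - f y)); last by ring.
  by apply: le_lt_trans (ler_normB _ _) _; lra.
move=> del /= del0 h; exists (del / 2); first by rewrite divr_gt0.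
move=> s t sT tT st; apply: (h (del / 2) _ _ s) => //=.
- by rewrite sub0r normrN ger0_norm; lra.
- by rewrite divr_gt0.
Qed.

Definition running_max := sup [set `|f t| | t in `[0, T]].

Let has_sup_path : has_sup [set `|f t| | t in `[0, T]].
Proof.
split; first by exists `|f 0|, 0 => //=; rewrite in_itv/= lexx ltW.
have cfT : {within `[0, T], continuous f}.
  by apply: continuous_subspaceW cf => x /=; rewrite !in_itv/= andbT => /andP[].
have [M [_ h]] := compact_bounded (continuous_compact cfT (@segment_compact R 0 T)).
exists (M + 1) => _ [t tT <-]; apply: (h (M + 1)); first by rewrite ltrDl.
by exists t.
Qed.

Lemma running_max_le x : (running_max <= x) <-> (forall t, 0 <= t <= T -> `|f t| <= x).
Proof.
split => [Mx t tT|h].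
  by apply: le_trans Mx; apply: ub_le_sup; [case: has_sup_path|exists t].
apply: ge_sup; first by case: has_sup_path.
by move=> _ [t tT <-]; exact: h.
Qed.

Lemma running_max_ge0 : 0 <= running_max.
Proof.
have /running_max_le/(_ 0) := lexx running_max.
by rewrite lexx ltW// => /(_ isT); exact: le_trans.
Qed.

Definition grid (n i : nat) : R := T * i%:R / n.+1%:R.

Lemma grid0 n : grid n 0 = 0.
Proof. by rewrite /grid mulr0 mul0r. Qed.

Lemma grid_last n : grid n n.+1 = T.
Proof. by rewrite /grid mulfK// pnatr_eq0. Qed.

Lemma grid_le n i j : (i <= j)%N -> grid n i <= grid n j.
Proof. by move=> ij; rewrite /grid ler_pM2r ?invr_gt0// ler_pM2l// ler_nat. Qed.

Lemma grid_itv n i : (i <= n.+1)%N -> 0 <= grid n i <= T.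
Proof. by move=> i_n; rewrite -{1}(grid0 n) -(grid_last n) !grid_le. Qed.

Lemma grid_step n i : grid n i.+1 - grid n i = T / n.+1%:R.
Proof. by rewrite /grid -[i.+1]addn1 natrD; ring. Qed.

Lemma grid_mesh e : 0 < e -> exists N, forall n, (N <= n)%N -> T / n.+1%:R < e.
Proof.
move=> e0; exists (Num.bound (T / e)) => n Nn.
rewrite ltr_pdivrMr// mulrC -ltr_pdivrMr//.
apply: (@lt_le_trans _ _ (Num.bound (T / e))%:R).
  by apply: archi_boundP; rewrite divr_ge0// ltW.
by rewrite ler_nat; apply: leq_trans Nn _.
Qed.

Lemma grid_oscillation e : 0 < e -> exists N, forall n i, (N <= n)%N -> (i < n.+1)%N ->
  `|f (grid n i.+1) - f (grid n i)| < e.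
Proof.
move=> e0; have [del del0 h] := path_uniform_continuity e0.
have [N hN] := grid_mesh del0; exists N => n i Nn i_n.
have gi : 0 <= grid n i <= T by apply: grid_itv; exact: ltnW.
have gi1 : 0 <= grid n i.+1 <= T by exact: grid_itv.
apply: (h _ _ gi1 gi); rewrite grid_step ger0_norm; first exact/ltW/hN.
by rewrite divr_ge0// ltW.
Qed.

Lemma grid_detects x : x < running_max ->
  exists N, forall n, (N <= n)%N -> exists2 i, (i < n.+2)%N & x < `|f (grid n i)|.
Proof.
move=> xM.
have [t tT xft] : exists2 t, 0 <= t <= T & x < `|f t|.
  apply: contrapT => h; have : running_max <= x.
    apply/running_max_le => t tT; rewrite leNgt; apply/negP => xt.
    by apply: h; exists t.
  by rewrite leNgt xM.
have e0 : 0 < `|f t| - x by rewrite subr_gt0.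
have [del del0 h] := path_uniform_continuity e0.
have [N hN] := grid_mesh del0; exists N => n Nn.
have /andP[t0 t1] := tT.
have nT : 0 <= t * n.+1%:R / T by rewrite divr_ge0 ?mulr_ge0// ltW.
pose i := Num.truncn (t * n.+1%:R / T).
have i_le : i%:R <= t * n.+1%:R / T by rewrite truncn_le.
have i_gt : t * n.+1%:R / T < i.+1%:R by exact: truncnS_gt.
have i_n : (i <= n.+1)%N.
  rewrite -(ler_nat R); apply: le_trans i_le _.
  by rewrite ler_pdivrMr// mulrC ler_wpM2l.
exists i => //.
have gt : `|grid n i - t| <= del.
  rewrite distrC ger0_norm; last first.
    by rewrite subr_ge0 /grid ler_pdivrMr// mulrC -ler_pdivlMr.
  apply: ltW; apply: le_lt_trans (hN n Nn); rewrite -(grid_step n i) lerD2r ltW//.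
  by rewrite /grid ltr_pdivlMr// [ltRHS]mulrC -ltr_pdivrMr.
have := h _ _ (grid_itv i_n) tT gt.
have := ler_normD (f (grid n i)) (f t - f (grid n i)).
rewrite addrC subrK distrC; lra.
Qed.

(** Countably many times suffice: the maximum is a measurable function of the
    path. *)
Lemma running_max_le_grid x :
  running_max <= x <-> forall n i, (i < n.+2)%N -> `|f (grid n i)| <= x.
Proof.
split => [/running_max_le h n i i_n|h]; first by apply: h; exact: grid_itv.
rewrite leNgt; apply/negP => /grid_detects[N /(_ N (leqnn N))[i iN]].
by rewrite ltNge h.
Qed.

End path_supremum.

(** * The two-sided reflection principle *)

Section running_max_measurable.
Context {d : measure_display} {Om : measurableType d} {R : realType}.
Variables (P : probability Om R) (H : R) (B : R -> {RV P >-> R}) (T : R).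
Hypotheses (fB : fractional_brownian_motion P H B) (T_gt0 : 0 < T).

Definition path_max (w : Om) := running_max (fun t => B t w) T.

Lemma path_max_le_grid x w :
  path_max w <= x <-> forall n i, (i < n.+2)%N -> `|B (grid T n i) w| <= x.
Proof. exact: (running_max_le_grid T_gt0 (fbm_continuous _ _ _ fB w)). Qed.

Lemma path_max_measurable : measurable_fun setT path_max.
Proof.
apply: (measurability _ (RGenOInfty.measurableE R)) => // _ [_ [x ->] <-].
rewrite setTI (_ : _ @^-1` _ =
  \bigcup_n \bigcup_(i in [set i | (i < n.+2)%N])
    ((fun w => `|B (grid T n i) w|) @^-1` `]x, +oo[)); last first.
  apply/seteqP; split=> w /=; rewrite in_itv/= andbT.
    move=> xM; apply: contrapT => h.
    have : path_max w <= x; last by rewrite leNgt xM.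
    apply/path_max_le_grid => n i i_n; rewrite leNgt; apply/negP => xi.
    by apply: h; exists n => //; exists i => //=; rewrite in_itv/= andbT.
  move=> [n _ [i /= i_n]]; rewrite in_itv/= andbT ltNge => xi; rewrite ltNge.
  by apply: contra xi => /path_max_le_grid; exact.
apply: bigcup_measurable => n _; apply: bigcup_measurable => i _.
by rewrite -[X in measurable X]setTI; apply: measurableT_comp.
Qed.

End running_max_measurable.

Lemma measurable_path_max_le {d : measure_display} {Om : measurableType d}
    {R : realType} (P : probability Om R) (H : R) (B : R -> {RV P >-> R}) (T x : R) :
  fractional_brownian_motion P H B -> 0 < T ->
  measurable_fun setT (fun w => (path_max B T w <= x)%R%:R : R).
Proof.
move=> fB T0; rewrite (_ : (fun w => _) = \1_(path_max B T @^-1` `]-oo, x])).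
  apply: measurable_indic; rewrite -[X in measurable X]setTI.
  exact: (path_max_measurable fB T0).
apply/funext => w; rewrite indicE; congr (_%:R); congr nat_of_bool.
by apply/idP/idP; rewrite inE /= in_itv.
Qed.

Section reflection_principle.
Context {d : measure_display} {Om : measurableType d} {R : realType}.
Variables (P : probability Om R) (B : R -> {RV P >-> R}) (T x : R) (g : R -> R) (L : R).
Hypotheses (fB : fractional_brownian_motion P (1 / 2) B) (T_gt0 : 0 < T) (x_gt0 : 0 < x).
Hypotheses (tg : trig_limit g) (g_le1 : forall y, `|g y| <= 1).
Hypothesis g_lipschitz : forall y z, `|g y - g z| <= L * `|y - z|.
Hypotheses (g_odd_right : forall y, g (2 * x - y) = - g y).
Hypotheses (g_odd_left : forall y, g (- (2 * x) - y) = - g y).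

Let S n i w := B (grid T n i) w.
Let inside n i w : R := (`|S n i w| <= x)%R%:R.
Let first_exit n i w : R := (\prod_(j < i) inside n j w) * (1 - inside n i w).
(** If the path left [- x, x] exactly at one of the two end points, g would take
    opposite values at B T and at its reflection: the sum measures the effect of
    the overshoot at the first exit along the grid. *)
Let error n w := \sum_(i < n.+2)
  first_exit n i w * ((g (B T w) + g (2 * S n i w - B T w)) / 2).

Let inside01 n i w : 0 <= inside n i w <= 1.
Proof. by rewrite /inside; case: (`|S n i w| <= x) => /=; rewrite ?ler01 ?lexx. Qed.

Let measurable_S n i : measurable_fun setT (S n i).
Proof. exact: measurable_funPT. Qed.

Let bounded_inside n i : bounded_rv (inside n i).
Proof. by apply: (bounded_rv_trig (trig_limit_norm_le (ltW x_gt0))). Qed.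

Let bounded_first_exit n i : bounded_rv (first_exit n i).
Proof.
apply: bounded_rvM; first exact: bounded_rv_prod.
by apply: (bounded_rvB (bounded_rv_cst 1)).
Qed.

Let first_exit_ge0 n i w : 0 <= first_exit n i w.
Proof.
apply: mulr_ge0; first by apply: prodr_ge0 => j _; case/andP: (inside01 n j w).
by rewrite subr_ge0; case/andP: (inside01 n i w).
Qed.

(** The first exit happens at one time at most. *)
Let sum_first_exit n m w :
  \sum_(i < m) first_exit n i w = 1 - \prod_(i < m) inside n i w.
Proof.
elim: m => [|m IH]; first by rewrite big_ord0 big_ord0 subrr.
by rewrite big_ord_recr /= IH big_ord_recr /= /first_exit; ring.
Qed.

Let sum_first_exit_le1 n m w : \sum_(i < m) first_exit n i w <= 1.
Proof.
rewrite sum_first_exit gerBl; apply: prodr_ge0 => i _.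
by case/andP: (inside01 n i w).
Qed.

Let bounded_gT : bounded_rv (fun w => g (B T w)).
Proof. by apply: bounded_rv_trig => //; exact: measurable_funPT. Qed.

Let bounded_gR n i : bounded_rv (fun w => g (2 * S n i w - B T w)).
Proof.
apply: bounded_rv_trig => //; apply: measurable_funB; last exact: measurable_funPT.
exact: measurable_funM.
Qed.

Let reflect_first_exit n i : (i < n.+2)%N ->
  \int[P]_w (first_exit n i w * g (B T w)) =
  \int[P]_w (first_exit n i w * ((g (B T w) + g (2 * S n i w - B T w)) / 2)).
Proof.
move=> i_n; have /andP[r0 rT] := grid_itv T_gt0 (i_n : (i <= n.+1)%N).
pose phi (j : nat) (y : R) : R := if j == i then (x < `|y|)%R%:R else (`|y| <= x)%R%:R.
have tphi j : trig_limit (phi j).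
  rewrite /phi; case: eqP => _; first exact: trig_limit_norm_gt (ltW x_gt0).
  exact: trig_limit_norm_le (ltW x_gt0).
have phiE w : \prod_(j < i.+1) phi j (B (grid T n j) w) = first_exit n i w.
  rewrite big_ord_recr /= {2}/phi eqxx /first_exit; congr (_ * _).
    by apply: eq_bigr => j _; rewrite /phi ltn_eqF.
  by rewrite /inside /S ltNge; case: (`|_| <= x) => /=; rewrite ?subrr ?subr0.
have gi j : (j < i.+1)%N -> 0 <= grid T n j <= grid T n i.
  by move=> ji; rewrite -{1}(grid0 T n) !grid_le.
have refl : \int[P]_w (first_exit n i w * g (B T w)) =
    \int[P]_w (first_exit n i w * g (2 * S n i w - B T w)).
  under eq_Rintegral do rewrite -phiE.
  under [RHS]eq_Rintegral do rewrite -phiE.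
  exact: (brownian_reflection fB gi r0 rT tphi tg).
have iT := bounded_rv_integrable P (bounded_rvM (bounded_first_exit n i) bounded_gT).
have iR := bounded_rv_integrable P (bounded_rvM (bounded_first_exit n i) (bounded_gR n i)).
transitivity (2^-1 * \int[P]_w (first_exit n i w * g (B T w) +
    first_exit n i w * g (2 * S n i w - B T w))).
  by rewrite Rint_add// -refl; field.
rewrite -Rint_scale; last exact: (integrableD measurableT iT iR).
by apply: eq_Rintegral => w _; field.
Qed.

Let Rint_sum n (F : nat -> Om -> R) : (forall i, bounded_rv (F i)) ->
  \int[P]_w (\sum_(i < n) F i w) = \sum_(i < n) \int[P]_w F i w.
Proof.
move=> bF; elim: n => [|n IH].
  by under eq_Rintegral do rewrite big_ord0; rewrite big_ord0 Rint_cst.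
under eq_Rintegral do rewrite big_ord_recr /=.
rewrite Rint_add ?IH ?big_ord_recr//; last exact: bounded_rv_integrable.
by apply: bounded_rv_integrable; exact: bounded_rv_sum.
Qed.

Let bounded_term n i : bounded_rv (fun w =>
  first_exit n i w * ((g (B T w) + g (2 * S n i w - B T w)) / 2)).
Proof.
apply: bounded_rvM => //.
rewrite (_ : (fun w => _) = (fun w => 2^-1 * (g (B T w) + g (2 * S n i w - B T w)))).
  by apply: bounded_rvZ; exact: (bounded_rvD bounded_gT).
by apply/funext => w; rewrite mulrC.
Qed.

Let bounded_error n : bounded_rv (error n).
Proof. exact: (bounded_rv_sum n.+2 (bounded_term n)). Qed.

(** Splitting along the first exit time, and replacing g (B T) on each piece by
    its average with its reflection. *)
Let grid_decomposition n :
  \int[P]_w g (B T w) =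
  \int[P]_w ((\prod_(i < n.+2) inside n i w) * g (B T w)) + \int[P]_w error n w.
Proof.
rewrite /error (Rint_sum _ (bounded_term n)).
under eq_bigr => i _ do rewrite -reflect_first_exit//.
rewrite -(Rint_sum _ (fun i => bounded_rvM (bounded_first_exit n i) bounded_gT)).
rewrite -Rint_add; last 2 first.
- apply: bounded_rv_integrable; apply: bounded_rvM => //.
  exact: (bounded_rv_prod n.+2 (bounded_inside n)).
- apply: bounded_rv_integrable.
  exact: (bounded_rv_sum n.+2 (fun i => bounded_rvM (bounded_first_exit n i) bounded_gT)).
by apply: eq_Rintegral => w _; rewrite -mulr_suml sum_first_exit; ring.
Qed.

Let error_le1 n w : `|error n w| <= 1.
Proof.
apply: le_trans (sum_first_exit_le1 n n.+2 w); apply: le_trans (ler_norm_sum _ _ _) _.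
apply: ler_sum => i _; rewrite normrM ger0_norm// ler_piMr//.
rewrite ler_norml; have := g_le1 (B T w); have := g_le1 (2 * S n i w - B T w).
by rewrite !ler_norml; lra.
Qed.

(** The overshoot is at most one step of the path along the grid, which tends to
    0 by uniform continuity; g being Lipschitz, so does the error. *)
Let error_cvg0 w : B 0 w = 0 -> error ^~ w @ \oo --> (0 : R).
Proof.
move=> B0; have L0 : 0 <= L.
  have := g_lipschitz 1 0; rewrite subr0 normr1 mulr1; exact: le_trans.
apply/cvgrPdist_le => e e0.
have eL : 0 < e / (L + 1) by rewrite divr_gt0//; lra.
have [N hN] := grid_oscillation T_gt0 (fbm_continuous _ _ _ fB w) eL.
exists N => // n /= Nn; rewrite sub0r normrN.
apply: (@le_trans _ _ (\sum_(i < n.+2) first_exit n i w * e)); last first.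
  by rewrite -mulr_suml ler_piMl ?sum_first_exit_le1// ltW.
apply: le_trans (ler_norm_sum _ _ _) _; apply: ler_sum => i _.
rewrite normrM ger0_norm//.
have [Si|Si] := leP `|S n i w| x.
  by rewrite /first_exit /inside Si subrr mulr0 !mul0r.
case: i Si => -[|i] i_n /= Si.
  by exfalso; move: Si; rewrite /S grid0 B0 normr0 ltNge ltW.
have [Si'|Si'] := leP `|S n i w| x; last first.
  have ins0 : inside n i w = 0 by rewrite /inside leNgt Si'.
  by rewrite /first_exit big_ord_recr /= ins0 mulr0 !mul0r.
rewrite ler_wpM2l//.
have step : `|S n i.+1 w| - x <= e / (L + 1).
  have := hN n i Nn i_n; rewrite -/(S n i.+1 w) -/(S n i w).
  have := ler_normD (S n i w) (S n i.+1 w - S n i w).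
  by rewrite addrC subrK; lra.
have Le : L * (e / (L + 1)) <= e.
  by rewrite mulrA ler_pdivrMr; nra.
rewrite normrM (ger0_norm (_ : 0 <= 2^-1))// ler_pdivrMr//.
have [S0|S0] := leP 0 (S n i.+1 w).
  rewrite (ger0_norm S0) in Si step.
  rewrite -[g (B T w)]opprK -g_odd_right addrC.
  apply: le_trans (g_lipschitz _ _) _.
  rewrite (_ : _ - _ = 2 * (S n i.+1 w - x)); last by ring.
  by rewrite ger0_norm; nra.
rewrite (ltr0_norm S0) in Si step.
rewrite -[g (B T w)]opprK -g_odd_left addrC.
apply: le_trans (g_lipschitz _ _) _.
rewrite (_ : _ - _ = - (2 * (- S n i.+1 w - x))); last by ring.
by rewrite normrN ger0_norm; nra.
Qed.

(** Paths that leave [- x, x] before time T do not contribute to the expectation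
    of g (B T), because g is odd about both exit points and the path restarted
    there is symmetric. *)
Lemma two_sided_reflection :
  \int[P]_w g (B T w) = \int[P]_w ((path_max B T w <= x)%R%:R * g (B T w)).
Proof.
have mle := measurable_path_max_le x fB T_gt0.
have c1 : \int[P]_w error n w @[n --> \oo] --> \int[P]_w (0 : R).
  apply: (@Rint_bounded_cvg _ _ _ P _ _ 1) => //.
  - by move=> n; case: (bounded_error n).
  - case: (fbm_start fB) => N [mN N0 h]; exists N; split=> // w /= e; apply: h => /= e'.
    by apply: e; exact: error_cvg0.
have c2 : \int[P]_w ((\prod_(i < n.+2) inside n i w) * g (B T w)) @[n --> \oo] -->
    \int[P]_w ((path_max B T w <= x)%R%:R * g (B T w)).
  apply: (@Rint_bounded_cvg _ _ _ P _ _ 1).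
  - move=> n; apply: measurable_funM; last by case: bounded_gT.
    by case: (bounded_rv_prod n.+2 (bounded_inside n)).
  - move=> n w; rewrite normrM mulr_ile1//.
    rewrite ger0_norm; last by apply: prodr_ge0 => i _; case/andP: (inside01 n i w).
    by apply: prodr_ile1 => i _; exact: inside01.
  - by apply: measurable_funM => //; case: bounded_gT.
  - apply: aeW => w; apply: cvgM; last exact: cvg_cst.
    apply: cvg_near_cst; have [Mx|Mx] := leP (path_max B T w) x.
      apply: nearW => n; apply: big1 => i _.
      by have /(path_max_le_grid fB T_gt0)/(_ n i (ltn_ord i)) := Mx; rewrite /inside /S => ->.
    have [N hN] := grid_detects T_gt0 (fbm_continuous _ _ _ fB w) Mx.
    exists N => // n /= /hN[i i_n xi]; apply/eqP; rewrite prodf_seq_eq0.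
    apply/hasP; exists (Ordinal i_n); first exact: mem_index_enum.
    by rewrite /= /inside /S leNgt xi.
have c3 := cvgD c2 c1 _; rewrite Rint_cst addr0 in c3.
rewrite -(cvg_lim _ (c3 _))//; apply/esym/cvg_lim => //.
rewrite (_ : (_ + _ : nat -> R) = cst (\int[P]_w g (B T w))); first exact: cvg_cst.
by apply/funext => n; rewrite [RHS](grid_decomposition n).
Qed.

End reflection_principle.

(** * One-dimensional laws of fractional Brownian motion *)

Section marginal_law.
Context {d : measure_display} {Om : measurableType d} {R : realType}.
Variables (P : probability Om R) (H : R) (B : R -> {RV P >-> R}).
Hypothesis fB : fractional_brownian_motion P H B.
Variables (t : R) (t_gt0 : 0 < t).

Lemma fbm_law A : measurable A -> P (B t @^-1` A) = normal_prob 0 (t `^ H) A.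
Proof.
move=> mA; have t0 := ltW t_gt0.
have g : gaussian P (B t).
  have := fbm_gaussian _ _ _ fB 1 (fun=> t) (fun=> 1) (fun=> t0).
  rewrite (_ : (fun w => _) = B t)//.
  by apply/funext => w; rewrite big_ord1 mul1r.
rewrite (gaussian_law g (fbm_sqint fB t0) (fbm_mean fB t0) (fbm_square fB t0))//.
rewrite gt_eqF ?powR_gt0//.
by rewrite mulrC powRrM powR_mulrn ?powR_ge0// sqrtr_sqr ger0_norm ?powR_ge0.
Qed.

Lemma fbm_neq c : {ae P, forall w, B t w != c}.
Proof.
exists (B t @^-1` [set c]); split.
- by rewrite -[X in measurable X]setTI; exact: measurable_funPT.
- rewrite fbm_law//; have /null_content_dominatesP := normal_prob_dominates (0 : R) (t `^ H).
  by apply=> //; exact: lebesgue_measure_set1.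
- by move=> w /= /negP; rewrite negbK => /eqP.
Qed.

Lemma fbm_abs_moment gamma : 0 < gamma ->
  (\int[P]_w (`|B t w| `^ gamma)%:E = (t `^ (H * gamma) *
    (1 / Num.sqrt pi * 2 `^ (gamma / 2) * euler_gamma ((gamma + 1) / 2)))%:E)%E.
Proof.
move=> gamma0; pose s := t `^ H; have s0 : 0 < s by rewrite powR_gt0.
have mB : measurable_fun setT (B t) by exact: measurable_funPT.
have mG : measurable_fun setT (fun y : R => `|y| `^ gamma).
  by apply: (measurableT_comp (measurable_powR gamma)); exact: normr_measurable.
rewrite EFinM -(normal_abs_moment gamma0).
rewrite -(ge0_expectation_normal s0 mB fbm_law mG (fun y => powR_ge0 _ _)).
rewrite -ge0_integralZl_EFin ?powR_ge0//; last first.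
  apply/measurable_EFinP; apply: (measurableT_comp mG); apply: measurable_funM => //.
  exact: measurable_funB.
apply: eq_integral => w _; rewrite -EFinM; congr EFin.
rewrite powRrM -powRM ?normr_ge0 ?powR_ge0// subr0 normrM normfV.
by rewrite (gtr0_norm s0) mulrC divfK// gt_eqF.
Qed.

End marginal_law.

(** * The tail of the two-sided maximum of Brownian motion *)

Section square_wave.
Context {R : realType}.
Implicit Types (x y z : R).

Lemma cos_lipschitz y z : `|cos y - cos z| <= `|y - z|.
Proof.
wlog yz : y z / y <= z.
  move=> h; have [/h//|/ltW/h] := leP y z.
  by rewrite distrC (distrC z).
have [c _ e] : exists2 c, c \in `[y, z] & cos z - cos y = - sin c * (z - y).
  apply: (@MVT_segment _ cos (fun u => - sin u)) => //.
  by apply: continuous_subspaceT; exact: continuous_cos.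
rewrite distrC e distrC normrM normrN ler_piMl// ler_norml.
by rewrite sin_geN1 sin_le1.
Qed.

(** cos (pi z / 2) changes sign exactly at the odd integers, and the truncated
    part counts those passed by z. *)
Lemma sg_cos_pi z : 0 <= z -> (forall k : nat, z != (2 * k + 1)%:R) ->
  Num.sg (cos (pi / 2 * z)) = (-1) ^+ Num.truncn ((z + 1) / 2).
Proof.
move=> z0 zodd; set n := Num.truncn _.
have w0 : 0 <= (z + 1) / 2 by rewrite divr_ge0//; lra.
have n1 : n%:R <= (z + 1) / 2 by rewrite truncn_le.
have n2 : (z + 1) / 2 < n.+1%:R by exact: truncnS_gt.
pose r := z - 2 * n%:R.
have rN1 : -1 < r.
  rewrite lt_neqAle; apply/andP; split; last by rewrite /r; lra.
  case: n n1 {n2} @r => [|n] n1 r; first by apply/eqP => h; move: h; rewrite /r mulr0; lra.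
  apply/eqP => h; have : z = (2 * n + 1)%:R.
    rewrite natrD natrM; have e : n%:R + 1 = n.+1%:R :> R by exact: natr1.
    by move: h; rewrite /r -e => h; lra.
  by move=> zE; have := zodd n; rewrite -zE eqxx.
have r1 : r < 1 by move: n2; rewrite -[n.+1]addn1 natrD /r; lra.
have -> : pi / 2 * z = pi / 2 * r + pi *+ n.
  by rewrite /r -mulr_natr; field.
rewrite (alternatingn (@cosDpi R)) sgrM sgrX sgrN1 gtr0_sg ?mulr1//.
by apply: cos_gt0_pihalf; have := @pi_gt0 R; nra.
Qed.

End square_wave.

Section maximum_tail.
Context {d : measure_display} {Om : measurableType d} {R : realType}.
Variables (P : probability Om R) (B : R -> {RV P >-> R}) (T x : R).
Hypotheses (fB : fractional_brownian_motion P (1 / 2) B) (T_gt0 : 0 < T) (x_gt0 : 0 < x).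

Let wave y := cos (pi / (2 * x) * y + 0).

Let wave_le1 y : `|wave y| <= 1.
Proof. by rewrite ler_norml cos_geN1 cos_le1. Qed.

Let wave_odd_right y : wave (2 * x - y) = - wave y.
Proof.
rewrite /wave (_ : _ + 0 = - (pi / (2 * x) * y + 0) + pi); last first.
  by field; rewrite gt_eqF.
by rewrite (@cosDpi R) cosN.
Qed.

Let wave_odd_left y : wave (- (2 * x) - y) = - wave y.
Proof.
rewrite -(wave_odd_right y) -[in LHS](opprK (_ - y)) /wave.
rewrite (_ : _ * _ + 0 = - (pi / (2 * x) * (2 * x + y) + 0)); last by ring.
rewrite cosN (_ : _ * (2 * x + y) + 0 = (pi / (2 * x) * y + 0) + pi); last first.
  by field; rewrite gt_eqF.
by rewrite (@cosDpi R) -wave_odd_right.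
Qed.

Let measurable_sg_wave : measurable_fun setT (fun w => Num.sg (wave (B T w))).
Proof.
by have [] := bounded_rv_trig (trig_limit_sg_cos (pi / (2 * x)) 0)
  (@measurable_funPT _ _ _ _ (B T)).
Qed.

(** The square wave itself is discontinuous; its Lipschitz approximations are
    polynomials in a cosine that is odd about x and - x. *)
Let exit_identity :
  \int[P]_w Num.sg (wave (B T w)) =
  \int[P]_w ((path_max B T w <= x)%R%:R * Num.sg (wave (B T w))).
Proof.
pose g n y := sgn_approx n (wave y).
have refl n : \int[P]_w g n (B T w) = \int[P]_w ((path_max B T w <= x)%R%:R * g n (B T w)).
  apply: (@two_sided_reflection _ _ _ _ _ _ _ _ (pi / (2 * x) * (n * 2 ^ n)%:R) fB T_gt0 x_gt0).
  - exact: trig_limit_sgn_approx.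
  - by move=> y; exact: sgn_approx_le1.
  - move=> y z; apply: le_trans (lipschitz_sgn_approx _ _ _) _ => //.
    rewrite -[leLHS]mulr_natr [leRHS]mulrAC ler_wpM2r//; apply: le_trans (cos_lipschitz _ _) _.
    rewrite (_ : _ - _ = pi / (2 * x) * (y - z)); last by ring.
    have k0 : 0 <= pi / (2 * x) by apply: divr_ge0; rewrite ?pi_ge0// mulr_ge0// ltW.
    by rewrite normrM ger0_norm.
  - by move=> y; rewrite /g wave_odd_right sgn_approxN.
  - by move=> y; rewrite /g wave_odd_left sgn_approxN.
have mg n : measurable_fun setT (fun w => g n (B T w)).
  by have [] := bounded_rv_trig (trig_limit_sgn_approx n (pi / (2 * x)) 0)
    (@measurable_funPT _ _ _ _ (B T)).
have mle := measurable_path_max_le x fB T_gt0.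
have c1 : \int[P]_w g n (B T w) @[n --> \oo] --> \int[P]_w Num.sg (wave (B T w)).
  apply: (@Rint_bounded_cvg _ _ _ P _ _ 1) => //.
  - by move=> n w; exact: sgn_approx_le1.
  - by apply: aeW => w; exact: sgn_approx_cvg.
have c2 : \int[P]_w ((path_max B T w <= x)%R%:R * g n (B T w)) @[n --> \oo] -->
    \int[P]_w ((path_max B T w <= x)%R%:R * Num.sg (wave (B T w))).
  apply: (@Rint_bounded_cvg _ _ _ P _ _ 1).
  - by move=> n; exact: measurable_funM.
  - move=> n w; rewrite normrM mulr_ile1// ?sgn_approx_le1//.
    by case: (path_max B T w <= x); rewrite ?normr1 ?normr0.
  - exact: measurable_funM.
  - by apply: aeW => w; apply: cvgM; [exact: cvg_cst|exact: sgn_approx_cvg].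
rewrite -(cvg_lim _ c1)// -(cvg_lim _ c2)//; congr (lim (_ @ \oo)).
by apply/funext => n; exact: refl.
Qed.

(** The union over j is, up to a null event, where the square wave is negative. *)
Definition band j w : Prop :=
  ((4 * j + 1)%:R * x < `|B T w|) && (`|B T w| <= (4 * j + 3)%:R * x).

Lemma band_measurable j : measurable [set w | band j w].
Proof.
rewrite (_ : [set w | _] = (fun w => `|B T w|) @^-1` `](4 * j + 1)%:R * x, (4 * j + 3)%:R * x]).
  by rewrite -[X in measurable X]setTI; apply: measurableT_comp.
by apply/seteqP; split => w; rewrite /band /= in_itv.
Qed.

(** Excludes the discontinuities of the square wave, an event of probability 0. *)
Let generic w := forall k : nat, `|B T w| != (2 * k + 1)%:R * x.

Let generic_ae : {ae P, forall w, generic w}.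
Proof.
apply: ae_foralln => k.
have h1 := fbm_neq fB T_gt0 ((2 * k + 1)%:R * x).
have h2 := fbm_neq fB T_gt0 (- ((2 * k + 1)%:R * x)).
have p : 0 <= (2 * k + 1)%:R * x by rewrite mulr_ge0// ltW.
near=> w.
have w1 : B T w != (2 * k + 1)%:R * x by near: w.
have w2 : B T w != - ((2 * k + 1)%:R * x) by near: w.
by rewrite -(ger0_norm p) eqr_norml normr_ge0 andbT negb_or !ger0_norm// w1.
Unshelve. all: by end_near. Qed.

Let sg_wave_parity w : generic w ->
  Num.sg (wave (B T w)) = (-1) ^+ Num.truncn ((`|B T w| / x + 1) / 2).
Proof.
move=> gw; rewrite -sg_cos_pi.
- congr Num.sg; rewrite /wave addr0.
  rewrite (_ : pi / 2 * (`|B T w| / x) = pi / (2 * x) * `|B T w|); last first.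
    by field; rewrite gt_eqF.
  by case: (ger0P (B T w)) => // _; rewrite mulrN cosN.
- by rewrite divr_ge0// ltW.
- move=> k; have := gw k; apply: contraNneq => <-.
  by rewrite divfK// gt_eqF.
Qed.

Let sg_wave_band w : generic w ->
  Num.sg (wave (B T w)) = 1 - 2 * \1_(\bigcup_j [set w | band j w]) w.
Proof.
move=> gw; rewrite sg_wave_parity//; set z := `|B T w| / x; set n := Num.truncn _.
have z0 : 0 <= z by rewrite divr_ge0// ltW.
have xz : `|B T w| = z * x by rewrite divfK// gt_eqF.
have w0 : 0 <= (z + 1) / 2 by rewrite divr_ge0//; lra.
have n1 : n%:R <= (z + 1) / 2 by rewrite truncn_le.
have n2 : (z + 1) / 2 < n.+1%:R by exact: truncnS_gt.
have n1E : n.+1%:R = n%:R + 1 :> R by rewrite natr1.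
rewrite -signr_odd indicE.
have -> : (w \in \bigcup_j [set w | band j w]) = odd n.
  apply/idP/idP.
    rewrite inE => -[j _ /andP[]]; rewrite xz ltr_pM2r// ler_pM2r// => j1 j2.
    have j3 : z != (4 * j + 3)%:R.
      have := gw (2 * j + 1)%N; rewrite xz; apply: contraNneq => ->.
      by rewrite (_ : (2 * (2 * j + 1) + 1)%N = (4 * j + 3)%N)//; lia.
    have {}j2 : z < (4 * j + 3)%:R by rewrite lt_neqAle j3.
    have -> : n = (2 * j + 1)%N; last by rewrite oddD oddM.
    move: j1 j2; rewrite !natrD ?natrM => j1 j2.
    apply/eqP; rewrite eqn_leq; apply/andP; split.
      by rewrite -ltnS -(ltr_nat R) -addn1 !natrD ?natrM; lra.
    by rewrite -ltnS -(ltr_nat R) !natrD ?natrM; lra.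
  move=> on; rewrite inE; exists n./2 => //.
  have nE : n%:R = 2 * (n./2)%:R + 1 :> R.
    by rewrite -{1}(odd_double_half n) on -mul2n natrD natrM addrC.
  rewrite /band /= xz ltr_pM2r// ler_pM2r// !natrD ?natrM.
  apply/andP; split; last by lra.
  rewrite lt_neqAle; apply/andP; split; last by lra.
  apply/eqP => e; have := gw (2 * n./2)%N; rewrite xz -e => /negP; apply; apply/eqP.
  by congr (_ * _); rewrite natrD !natrM; ring.
by case: (odd n) => /=; rewrite ?expr1 ?expr0; lra.
Qed.

Let sg_wave_inside w : generic w -> path_max B T w <= x -> Num.sg (wave (B T w)) = 1.
Proof.
move=> gw Mx; rewrite sg_wave_parity//.
have Bx : `|B T w| <= x.
  have /(path_max_le_grid fB T_gt0)/(_ 0 1 isT) := Mx.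
  by rewrite (grid_last T 0).
have {}Bx : `|B T w| < x.
  by rewrite lt_neqAle Bx andbT; have := gw 0; rewrite mul1r.
have z1 : `|B T w| / x < 1 by rewrite ltr_pdivrMr// mul1r.
have z0 : 0 <= `|B T w| / x by rewrite divr_ge0// ltW.
rewrite (_ : Num.truncn _ = 0%N) ?expr0//.
apply/eqP; rewrite -leqn0 -ltnS -(ltr_nat R).
by apply: le_lt_trans (_ : (`|B T w| / x + 1) / 2 < 1); [rewrite truncn_le; lra|lra].
Qed.

Let band_trivIset : trivIset setT (fun j => [set w | band j w]).
Proof.
apply/trivIsetP => i j _ _; wlog ij : i j / (i < j)%N => [h|_].
  by rewrite neq_ltn => /orP[ij|ij]; [|rewrite setIC]; apply: h => //; rewrite ltn_eqF.
rewrite -subset0 => w [/= /andP[_ h1] /andP[h2 _]].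
have := lt_le_trans h2 h1; rewrite ltr_pM2r// ltr_nat.
by lia.
Qed.

Let Rint_indic (A : set Om) : measurable A -> \int[P]_w \1_A w = fine (P A).
Proof. by move=> mA; rewrite /Rintegral integral_indic// setIT. Qed.

(** The sign of the wave at B T is 1 if the path stays in [- x, x], and averages
    to 0 otherwise; on the other hand its mean is 1 minus twice the probability
    of the bands. *)
Lemma path_max_tail :
  (P [set w | (x < path_max B T w)%R] = 2%:E * \sum_(0 <= j <oo) P [set w | band j w])%E.
Proof.
pose U := \bigcup_j [set w | band j w]; pose E := [set w | (x < path_max B T w)%R].
have mU : measurable U by apply: bigcup_measurable => j _; exact: band_measurable.
have mE : measurable E.
  rewrite (_ : E = path_max B T @^-1` `]x, +oo[).
    by rewrite -[X in measurable X]setTI; exact: (path_max_measurable fB T_gt0).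
  by apply/seteqP; split => w; rewrite /E /= in_itv/= andbT.
have Rint_compl c (A : set Om) : measurable A ->
    \int[P]_w (1 - c * \1_A w) = 1 - c * fine (P A).
  move=> mA; have i1 : P.-integrable setT (EFin \o (\1_A : Om -> R)).
    exact: integrable_indic.
  rewrite RintegralB//.
  - by rewrite Rint_cst Rint_scale// Rint_indic.
  - exact: finite_measure_integrable_cst.
  - rewrite (_ : EFin \o _ = (fun w => c%:E * (\1_A w)%:E)%E)//.
    exact: integrableZl.
have mcompl c (A : set Om) : measurable A -> measurable_fun setT (fun w => 1 - c * \1_A w : R).
  by move=> mA; apply: measurable_funB => //; apply: measurable_funM => //; exact: measurable_indic.
have leE w : (path_max B T w <= x)%R%:R = 1 - 1 * \1_E w :> R.
  rewrite indicE mul1r; case: leP => Mx.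
    by rewrite memNset ?subr0// /E /= ltNge Mx.
  by rewrite mem_set// subrr.
have := exit_identity.
have -> : \int[P]_w Num.sg (wave (B T w)) = \int[P]_w (1 - 2 * \1_U w).
  apply: ae_eq_Rint => //; first exact: mcompl.
  by apply: filterS generic_ae => w; exact: sg_wave_band.
have -> : \int[P]_w ((path_max B T w <= x)%R%:R * Num.sg (wave (B T w))) =
    \int[P]_w (1 - 1 * \1_E w).
  apply: ae_eq_Rint; [|exact: mcompl|].
    apply: measurable_funM => //; rewrite (_ : (fun w => _) = (fun w => 1 - 1 * \1_E w)).
      exact: mcompl.
    by apply/funext => w; exact: leE.
  apply: filterS generic_ae => w gw; rewrite leE.
  have [Mx|Mx] := leP (path_max B T w) x; first by rewrite sg_wave_inside// mulr1.
  by rewrite indicE mem_set// mulr1 subrr mul0r.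
rewrite !Rint_compl// mul1r => /addrI /oppr_inj h.
rewrite -/E -[LHS]fineK ?fin_num_measure// -h EFinM fineK ?fin_num_measure//.
rewrite /U measure_bigcup//; last by move=> j _; exact: band_measurable.
by congr (_ * _)%E; apply: eq_eseriesl => j; rewrite in_setT.
Qed.

End maximum_tail.

(** * Integrating the tail *)

Section tail_integral.
Context {d : measure_display} {Om : measurableType d} {R : realType}.
Variable P : probability Om R.
Local Notation mu := (@lebesgue_measure R).

Lemma measurable_tail (X : Om -> R) (D : set R) : measurable_fun setT X ->
  measurable_fun D (fun r => P [set w | (r < X w)%R]).
Proof.
move=> mX; pose X' : {RV P >-> R} := HB.pack X (isMeasurableFun.Build _ _ _ _ X mX).
apply: measurable_funTS; apply: eq_measurable_fun (ccdf_measurable X') => r _.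
rewrite /ccdf /distribution /pushforward; congr (P _).
by apply/seteqP; split => w /=; rewrite in_itv/= andbT.
Qed.

Lemma ge0_expectation_tail (X : Om -> R) : measurable_fun setT X ->
  (forall w, 0 <= X w) ->
  (\int[P]_w (X w)%:E = \int[mu]_(r in `]0%R, +oo[) P [set w | (r < X w)%R])%E.
Proof.
move=> mX X0; pose X' : {RV P >-> R} := HB.pack X (isMeasurableFun.Build _ _ _ _ X mX).
have := @ge0_expectation_ccdf _ _ _ _ X' X0; rewrite unlock => ->.
rewrite -integral_itv_obnd_cbnd; last by apply: measurable_funTS; exact: ccdf_measurable.
apply: eq_integral => r _; rewrite /ccdf /distribution /pushforward; congr (P _).
by apply/seteqP; split => w /=; rewrite in_itv/= andbT.
Qed.

End tail_integral.

Section powers.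
Context {R : realType}.
Implicit Types (a b x y gamma : R).

Lemma ltr_powR gamma a b : 0 < gamma -> 0 <= a -> 0 <= b ->
  (a `^ gamma < b `^ gamma) = (a < b).
Proof.
move=> g0 a0 b0; apply/idP/idP; last by apply: gt0_ltr_powR; rewrite ?nnegrE.
by apply: contraTT; rewrite -!leNgt; apply: ge0_ler_powR; rewrite ?nnegrE// ltW.
Qed.

Lemma powR_invK gamma r : 0 < gamma -> 0 <= r -> (r `^ gamma^-1) `^ gamma = r.
Proof. by move=> g0 r0; rewrite -powRrM mulVf ?gt_eqF// powRr1. Qed.

End powers.

Section brownian_maximum_moment.
Context {d : measure_display} {Om : measurableType d} {R : realType}.
Variables (P : probability Om R) (B : R -> {RV P >-> R}) (T gamma C : R).
Hypotheses (fB : fractional_brownian_motion P (1 / 2) B) (T_gt0 : 0 < T).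
Hypothesis gamma_gt0 : 0 < gamma.
Hypothesis moment : (\int[P]_w (`|B T w| `^ gamma)%:E = C%:E)%E.
Local Notation mu := (@lebesgue_measure R).

(** With r = x ^ gamma, the band between a x and b x is the event V b <= r < V a;
    integrating over r turns bands into differences of moments of |B T|. *)
Let V (c : R) w := (`|B T w| / c) `^ gamma.

Let measurable_V c : measurable_fun setT (V c).
Proof.
apply: (measurableT_comp (measurable_powR gamma)); apply: measurable_funM => //.
exact: measurableT_comp.
Qed.

Let V_ge0 c w : 0 <= V c w. Proof. exact: powR_ge0. Qed.

Let expectation_V c : 0 < c -> (\int[P]_w (V c w)%:E = (C * c `^ (- gamma))%:E)%E.
Proof.
move=> c0; rewrite mulrC EFinM -moment -ge0_integralZl_EFin ?powR_ge0//; last first.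
  apply/measurable_EFinP; apply: (measurableT_comp (measurable_powR gamma)).
  exact: measurableT_comp.
apply: eq_integral => w _; rewrite -EFinM; congr EFin.
by rewrite /V powRM ?invr_ge0 ?(ltW c0)// mulrC powRN -powR_inv1 ?(ltW c0)// -powRrM mulN1r powRN.
Qed.

Let slice (a b r : R) := P [set w | (r < V a w)%R && ~~ (r < V b w)%R].

Let measurable_above (b r : R) : measurable [set w | (r < V b w)%R].
Proof.
rewrite (_ : [set w | _] = V b @^-1` `]r, +oo[).
  by rewrite -[X in measurable X]setTI; exact: measurable_V.
by apply/seteqP; split => w /=; rewrite in_itv/= andbT.
Qed.

Let measurable_slice_set (a b r : R) : measurable [set w | (r < V a w)%R && ~~ (r < V b w)%R].
Proof.
rewrite (_ : [set w | _] = (V a @^-1` `]r, +oo[) `\` (V b @^-1` `]r, +oo[)).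
  by apply: measurableD; rewrite -[X in measurable X]setTI; exact: measurable_V.
apply/seteqP; split => w /=; rewrite !in_itv/= !andbT.
  by move=> /andP[? /negP].
by move=> [-> /negP ->].
Qed.

Let slice_split (a b r : R) : 0 < a -> a <= b -> (P [set w | (r < V a w)%R] =
  slice a b r + P [set w | (r < V b w)%R])%E.
Proof.
move=> a0 ab; have b0 := lt_le_trans a0 ab.
rewrite /slice -measureU//.
- congr (P _); apply/seteqP; split => w /=.
    by case: (ltP r (V b w)) => h1 h2; [right|left; rewrite h2].
  case=> [/andP[]//|h]; apply: (lt_le_trans h).
  apply: ge0_ler_powR; rewrite ?nnegrE ?divr_ge0 ?(ltW a0) ?(ltW b0) ?(ltW gamma_gt0)//.
  by rewrite ler_wpM2l// lef_pV2.
- by apply/seteqP; split => w //= [/andP[_ /negP]].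
Qed.

Let measurable_slice (a b : R) : 0 < a -> a <= b ->
  measurable_fun (`]0%R, +oo[%classic : set R) (slice a b).
Proof.
move=> a0 ab; rewrite (_ : slice a b =
    (fun r => P [set w | (r < V a w)%R] - P [set w | (r < V b w)%R])%E).
  by apply: emeasurable_funB; exact: measurable_tail.
by apply/funext => r; rewrite (slice_split _ a0 ab) addeK// fin_num_measure.
Qed.

Let integral_slice (a b : R) : 0 < a -> a <= b ->
  (\int[mu]_(r in `]0%R, +oo[) slice a b r =
   (C * (a `^ (- gamma) - b `^ (- gamma)))%:E)%E.
Proof.
move=> a0 ab; have b0 := lt_le_trans a0 ab.
have : (\int[P]_w (V a w)%:E =
    \int[mu]_(r in `]0%R, +oo[) slice a b r + \int[P]_w (V b w)%:E)%E.
  rewrite !ge0_expectation_tail// -ge0_integralD//.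
  - by apply: eq_integral => r _; exact: slice_split.
  - exact: measurable_slice.
  - exact: measurable_tail.
rewrite !expectation_V// => e.
rewrite mulrBr EFinB e addeK//.
Qed.

Lemma brownian_maximum_moment_series :
  (\int[P]_w (path_max B T w `^ gamma)%:E =
   2%:E * \sum_(0 <= j <oo)
     (C * ((4 * j + 1)%:R `^ (- gamma) - (4 * j + 3)%:R `^ (- gamma)))%:E)%E.
Proof.
have c1 (j : nat) : 0 < (4 * j + 1)%:R :> R by rewrite ltr0n addn1.
have c13 (j : nat) : (4 * j + 1)%:R <= (4 * j + 3)%:R :> R by rewrite ler_nat; lia.
have mM := path_max_measurable fB T_gt0.
have M0 w : 0 <= path_max B T w.
  exact: (running_max_ge0 T_gt0 (fbm_continuous _ _ _ fB w)).
rewrite ge0_expectation_tail; last 2 first.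
- exact: (measurableT_comp (measurable_powR gamma)).
- by move=> w; exact: powR_ge0.
transitivity (\int[mu]_(r in `]0%R, +oo[)
    (2%:E * \sum_(0 <= j <oo) slice (4 * j + 1)%:R (4 * j + 3)%:R r))%E.
  apply: eq_integral => r; rewrite inE/= in_itv/= andbT => r0.
  pose x := r `^ gamma^-1; have x0 : 0 < x by rewrite powR_gt0.
  have rE : r = x `^ gamma by rewrite powR_invK// ltW.
  rewrite (_ : [set w | _] = [set w | (x < path_max B T w)%R]); last first.
    by apply/seteqP; split => w /=; rewrite rE ltr_powR// ltW.
  rewrite (path_max_tail fB T_gt0 x0); congr (_ * _)%E; apply: eq_eseriesr => j _.
  congr (P _); apply/seteqP; split => w /=; rewrite /band /V rE.
    rewrite !ltr_powR ?divr_ge0 ?(ltW x0)//.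
    by rewrite -leNgt ltr_pdivlMr// ler_pdivrMr ?(lt_le_trans (c1 j))// ![x * _]mulrC.
  rewrite !ltr_powR ?divr_ge0 ?(ltW x0)//.
  by rewrite -leNgt ltr_pdivlMr// ler_pdivrMr ?(lt_le_trans (c1 j))// ![x * _]mulrC.
rewrite ge0_integralZl_EFin//; last 2 first.
- by move=> r _; apply: nneseries_ge0 => j _ _; exact: measure_ge0.
- apply: ge0_emeasurable_sum => // j _; exact: measurable_slice.
congr (_ * _)%E; rewrite integral_nneseries//; last by move=> j; exact: measurable_slice.
by apply: eq_eseriesr => j _; exact: integral_slice.
Qed.

End brownian_maximum_moment.

(** * The Dirichlet beta series *)

Section dirichlet_beta_series.
Context {R : realType}.
Variables (gamma : R) (gamma_gt0 : 0 < gamma).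

Let u (k : nat) : R := (2 * k + 1)%:R `^ (- gamma).
Let s (n : nat) : R := \sum_(0 <= k < n) (-1) ^+ k * u k.
Let b (j : nat) : R := (4 * j + 1)%:R `^ (- gamma) - (4 * j + 3)%:R `^ (- gamma).

Let u_ge0 k : 0 <= u k. Proof. exact: powR_ge0. Qed.

Let u_dec k : u k.+1 <= u k.
Proof.
rewrite /u !powRN lef_pV2 ?posrE ?powR_gt0 ?ltr0n ?addn1//.
apply: ge0_ler_powR; rewrite ?nnegrE ?(ltW gamma_gt0)// ler_nat.
by rewrite ltnS leq_mul2l leqnSn.
Qed.

Let u_cvg0 : u @ \oo --> (0 : R).
Proof.
apply/cvgrPdist_lt => e e0; pose A := (e^-1) `^ gamma^-1.
have e1 : 0 <= e^-1 by rewrite invr_ge0 ltW.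
exists (Num.bound A) => // k /= Ak; rewrite sub0r normrN ger0_norm//.
rewrite /u powRN invf_plt ?posrE ?powR_gt0 ?ltr0n ?addn1//.
rewrite -(powR_invK gamma_gt0 e1) ltr_powR ?powR_ge0//.
apply: (@lt_le_trans _ _ (Num.bound A)%:R); first by apply: archi_boundP; exact: powR_ge0.
by rewrite ler_nat; lia.
Qed.

Let bE j : b j = u (2 * j) - u (2 * j).+1.
Proof.
rewrite /b /u (_ : (4 * j + 1 = 2 * (2 * j) + 1)%N); last by lia.
by rewrite (_ : (4 * j + 3 = 2 * (2 * j).+1 + 1)%N); last by lia.
Qed.

Let b_ge0 j : 0 <= b j. Proof. by rewrite bE subr_ge0. Qed.

Let sum_b n : \sum_(0 <= j < n) b j = s (2 * n).
Proof.
elim: n => [|n IH]; first by rewrite muln0 /s !big_nil.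
rewrite big_nat_recr//= IH (_ : (2 * n.+1 = (2 * n).+2)%N); last by lia.
rewrite /s !big_nat_recr//= -addrA; congr (_ + _).
by rewrite bE exprS exprM sqrrN expr1n expr1n; ring.
Qed.

Let sum_b_le n : \sum_(0 <= j < n) b j <= u 0 - u (2 * n).
Proof.
elim: n => [|n IH]; first by rewrite big_nil subrr.
rewrite big_nat_recr//= bE; apply: le_trans (lerD IH (lexx _)) _.
by rewrite (_ : (2 * n.+1 = (2 * n).+2)%N); [have := u_dec (2 * n).+1; lra|lia].
Qed.

Let s_half m : s m = \sum_(0 <= j < m./2) b j + (odd m)%:R * u (2 * m./2).
Proof.
rewrite sum_b -{1}(odd_double_half m) -mul2n; case: (odd m) => /=; last first.
  by rewrite add0n mul0r addr0.
by rewrite add1n /s big_nat_recr//= exprM sqrrN expr1n expr1n !mul1r.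
Qed.

(** The bands produce the terms of the beta series in pairs; since the terms tend
    to 0, grouping does not change the sum. *)
Lemma dirichlet_beta_pairs :
  (\sum_(0 <= j <oo) (b j)%:E = (dirichlet_beta gamma)%:E)%E.
Proof.
pose S n := \sum_(0 <= j < n) b j.
have Snd : nondecreasing_seq S.
  by apply/nondecreasing_seqP => n; rewrite /S big_nat_recr//= lerDl.
have Scvg : cvgn S.
  apply: nondecreasing_is_cvgn => //; exists (u 0) => _ [n _ <-].
  by apply: le_trans (sum_b_le n) _; rewrite gerBl.
have half_oo : (fun m => m./2) @ \oo --> \oo.
  move=> A [N _ NA]; exists (2 * N)%N => // m /= Nm; apply: NA => /=.
  by rewrite -leq_double; lia.
have scvg : s @ \oo --> limn S.
  rewrite (_ : s = (S \o half) \+ (fun m => (odd m)%:R * u (2 * m./2))); last first.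
    by apply/funext => m; exact: s_half.
  rewrite -[X in _ --> X]addr0; apply: cvgD; first exact: cvg_comp half_oo Scvg.
  apply: (@squeeze_cvgr _ _ _ _ (fun=> 0) (fun m => u (2 * m./2))).
  - apply: nearW => m; case: (odd m); rewrite ?mul1r ?mul0r lexx ?u_ge0//.
  - exact: cvg_cst.
  - apply: (cvg_comp (fun m => 2 * m./2)%N u); last exact: u_cvg0.
    move=> A [N _ NA]; exists (2 * N)%N => // m /= Nm; apply: NA => /=; lia.
have -> : dirichlet_beta gamma = limn S.
  by rewrite -(cvg_lim _ scvg).
rewrite -EFin_lim//; congr (lim (_ @ \oo)); apply/funext => n /=.
by rewrite /S sumEFin.
Qed.

End dirichlet_beta_series.

(** * Hurst index one *)

Section linear_paths.
Context {d : measure_display} {Om : measurableType d} {R : realType}.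
Variables (P : probability Om R) (B : R -> {RV P >-> R}) (T : R).
Hypotheses (fB : fractional_brownian_motion P 1 B) (T_gt0 : 0 < T).

(** B t - (t / T) B T has variance 0, the covariance function being s t. *)
Lemma fbm1_linear t : 0 <= t <= T -> {ae P, forall w, B t w = t / T * B T w}.
Proof.
move=> /andP[t0 tT]; have T0 := ltW T_gt0.
have [st sT] := (fbm_sqint fB t0, fbm_sqint fB T0).
pose X w := B t w + - (t / T) * B T w.
have sX : sqint P X by apply: sqintD => //; exact: sqintZ.
have sq r : 0 <= r -> r `^ (2 * 1) = r ^+ 2 by move=> r0; rewrite mulr1 powR_mulrn.
have X0 : \int[P]_w (X w ^+ 2) = 0.
  have it : P.-integrable setT (EFin \o (fun w => B t w * B t w)) by exact: sqintM_integrable.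
  have itT : P.-integrable setT (EFin \o (fun w => B t w * B T w)) by exact: sqintM_integrable.
  have iT : P.-integrable setT (EFin \o (fun w => B T w * B T w)) by exact: sqintM_integrable.
  have izl c (f : Om -> R) : P.-integrable setT (EFin \o f) ->
      P.-integrable setT (EFin \o (fun w => c * f w)).
    by move=> jf; rewrite (_ : EFin \o _ = (fun w => c%:E * (f w)%:E)%E)//; exact: integrableZl.
  transitivity (\int[P]_w (B t w * B t w + (- (2 * (t / T)) * (B t w * B T w) +
      (t / T) ^+ 2 * (B T w * B T w)))).
    by apply: eq_Rintegral => w _; rewrite /X; ring.
  rewrite Rint_add//; last exact: (integrableD measurableT (izl _ _ itT) (izl _ _ iT)).
  rewrite (Rint_add (izl _ _ itT) (izl _ _ iT)) !Rint_scale//.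
  rewrite !(fbm_covariance fB)// !sq ?subr_ge0// !subrr.
  by field; rewrite gt_eqF.
apply: filterS (Rint_square_eq0 sX X0) => w.
by rewrite /X mulNr => /eqP; rewrite subr_eq0 => /eqP.
Qed.

Lemma fbm1_path_max : {ae P, forall w, path_max B T w = `|B T w|}.
Proof.
have lin : {ae P, forall w, forall n i, (i < n.+2)%N ->
    B (grid T n i) w = grid T n i / T * B T w}.
  apply: ae_foralln => n; apply: ae_foralln => i.
  have [i_n|i_n] := ltnP i n.+2; last by apply: aeW.
  by have i_n1 : (i <= n.+1)%N := i_n; apply: filterS (fbm1_linear (grid_itv T_gt0 i_n1)) => w h _.
apply: filterS lin => w lin; apply/eqP; rewrite eq_le; apply/andP; split.
  apply/(path_max_le_grid fB T_gt0) => n i i_n; rewrite lin//.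
  have /andP[g0 g1] := grid_itv T_gt0 (i_n : (i <= n.+1)%N).
  have q0 : 0 <= grid T n i / T by rewrite divr_ge0// ltW.
  have q1 : grid T n i / T <= 1 by rewrite ler_pdivrMr// mul1r.
  by rewrite normrM (ger0_norm q0) ler_piMl.
have /(path_max_le_grid fB T_gt0)/(_ 0 1 isT) := lexx (path_max B T w).
by rewrite (grid_last T 0).
Qed.

End linear_paths.

Unset Implicit Arguments.

Theorem proposition1p2 (R : realType) (gamma T : R)
    (hgamma : 0 < gamma) (hT : 0 < T)
    (d : measure_display) (Om : measurableType d) (P : probability Om R) :
  (forall B : R -> {RV P >-> R}, fractional_brownian_motion P (1 / 2) B ->
    sup_moment P B T gamma =
      (1 / Num.sqrt pi * 2 `^ (1 + gamma / 2) * euler_gamma ((gamma + 1) / 2)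
        * dirichlet_beta gamma * T `^ (gamma / 2))%:E) /\
  (forall B : R -> {RV P >-> R}, fractional_brownian_motion P 1 B ->
    sup_moment P B T gamma =
      (1 / Num.sqrt pi * 2 `^ (gamma / 2) * euler_gamma ((gamma + 1) / 2)
        * T `^ gamma)%:E).
Proof.
have momentE (B : R -> {RV P >-> R}) :
    sup_moment P B T gamma = (\int[P]_w (path_max B T w `^ gamma)%:E)%E.
  by rewrite /sup_moment unlock.
split=> B fB; rewrite momentE.
- have moment := fbm_abs_moment fB hT hgamma.
  rewrite (brownian_maximum_moment_series fB hT hgamma moment).
  under eq_eseriesr => j _ do rewrite EFinM.
  rewrite nneseriesZl; last first.
    move=> j _; rewrite lee_fin subr_ge0 !powRN lef_pV2 ?posrE ?powR_gt0 ?ltr0n ?addn3 ?addn1//.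
    apply: ge0_ler_powR; rewrite ?nnegrE ?(ltW hgamma)// ler_nat; lia.
  rewrite (dirichlet_beta_pairs hgamma) -!EFinM; congr EFin.
  rewrite powRD; last by rewrite pnatr_eq0 implybT.
  rewrite powRr1// (_ : 1 / 2 * gamma = gamma / 2); first by ring.
  by field.
- transitivity (\int[P]_w (`|B T w| `^ gamma)%:E)%E.
    apply: ae_eq_integral => //.
    + apply/measurable_EFinP; apply: (measurableT_comp (measurable_powR gamma)).
      exact: (path_max_measurable fB hT).
    + apply/measurable_EFinP; apply: (measurableT_comp (measurable_powR gamma)).
      exact: measurableT_comp.
    + by apply: filterS (fbm1_path_max fB hT) => w e _; rewrite e.
  by rewrite (fbm_abs_moment fB hT hgamma) mul1r; congr EFin; rewrite mulrC.
Qed.
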